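(* Let $(\Omega,\mathcal A)$ be a measurable space and let $f$ be a random holomorphic function on the polydisc $\mathbb D^n=\{z\in\mathbb C^n:|z_j|<1,\ j=1,\dots,n\}$. Then $f$ is the sum of a random power series: there are measurable functions $a_\alpha:\Omega\to\mathbb C$, $\alpha\in(\mathbb N\cup\{0\})^n$, such that $f(\omega,z)=\sum_\alpha a_\alpha(\omega)z^\alpha$ for all $\omega\in\Omega$ and $z\in\mathbb D^n$.
   Context: A random holomorphic function on an open set $U\subset\mathbb C^n$ is a function $f:\Omega\times U\to\mathbb C$ such that $f(\omega,\cdot)$ is holomorphic for each $\omega\in\Omega$ and $f(\cdot,z)$ is measurable for each $z\in U$. A random power series is an expression $\sum_\alpha a_\alpha(\omega)z^\alpha$ with each coefficient $a_\alpha$ measurable. *)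

(* Defs.v *)
From HB Require Import structures.
From mathcomp Require Import all_boot all_order all_algebra.
From mathcomp Require Import complex.
From mathcomp Require Import all_classical all_reals all_analysis.
Set Implicit Arguments. Unset Strict Implicit. Unset Printing Implicit Defensive.
Import Order.TTheory GRing.Theory Num.Theory ComplexField.
Local Open Scope ring_scope.
Local Open Scope complex_scope.

Definition polydisc (R : realType) (n : nat) : set ('I_n -> R[i]) :=
  [set z | forall j : 'I_n, `|z j| < 1].

Definition supnorm (R : realType) (n : nat) (h : 'I_n -> R[i]) : R[i] :=
  \big[Num.max/0]_(j < n) `|h j|.

Definition C_differentiable_at (R : realType) (n : nat)
  (f : ('I_n -> R[i]) -> R[i]) (z : 'I_n -> R[i]) : Prop :=
  exists c : 'I_n -> R[i],
    forall eps : R, 0 < eps -> exists2 delta : R, 0 < delta &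
      forall h : 'I_n -> R[i], (forall j, `|h j| < delta%:C) ->
        `|f (fun j => z j + h j) - f z - \sum_(j < n) c j * h j|
          <= eps%:C * supnorm h.

Definition holomorphic_on (R : realType) (n : nat) (U : set ('I_n -> R[i]))
  (f : ('I_n -> R[i]) -> R[i]) : Prop :=
  forall z, U z -> C_differentiable_at f z.

Definition measurable_C (d : measure_display) (T : measurableType d)
  (R : realType) (g : T -> R[i]) : Prop :=
  measurable_fun [set: T] (fun w => complex.Re (g w) : R) /\
  measurable_fun [set: T] (fun w => complex.Im (g w) : R).

Definition random_holomorphic (d : measure_display) (Omega : measurableType d)
  (R : realType) (n : nat) (U : set ('I_n -> R[i]))
  (f : Omega -> ('I_n -> R[i]) -> R[i]) : Prop :=
  (forall w, holomorphic_on U (f w)) /\ (forall z, U z -> measurable_C (f ^~ z)).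

Definition monomial (R : realType) (n : nat) (alpha : n.-tuple nat)
  (z : 'I_n -> R[i]) : R[i] := \prod_(j < n) z j ^+ tnth alpha j.

Definition has_sum (R : realType) (n : nat) (u : n.-tuple nat -> R[i])
  (s : R[i]) : Prop :=
  forall eps : R, 0 < eps -> exists s0 : seq (n.-tuple nat),
    forall s1 : seq (n.-tuple nat), uniq s1 -> {subset s0 <= s1} ->
      `|\sum_(alpha <- s1) u alpha - s| < eps%:C.

(* Main.v *)
(** The Taylor coefficients are Cauchy integrals over a torus, that is, limits of
    Riemann sums in the values of f, which are measurable in the random
    parameter; so the point is a Cauchy formula valid for Riemann sums and for
    functions that are merely complex differentiable.  The torus of radius rho
    is shrunk to the point z by T |-> z + s (T - z); the integrand of Cauchy's formula
    along this homotopy is a divergence-free vector field on a cube, and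
    Goursat's bisection shows that the Riemann sums of its flux through the
    boundary tend to 0.  Truncating the Cauchy kernel into a finite geometric
    sum turns the formula into a polynomial approximation of f with a geometric
    rate, hence into the power series expansion.  That the coefficients do not
    depend on rho follows by integrating the expansion over a smaller torus. *)
Require Import Defs.
From HB Require Import structures.
From mathcomp Require Import all_boot all_order all_algebra.
From mathcomp Require Import complex.
From mathcomp Require Import all_classical all_reals all_analysis.
From mathcomp Require Import measurable_realfun ring lra zify.
Import Order.TTheory GRing.Theory Num.Theory ComplexField.
Local Open Scope ring_scope.

Set Implicit Arguments. Unset Strict Implicit. Unset Printing Implicit Defensive.
Local Open Scope complex_scope.

(** * The modulus and dyadic boxes *)

Section Modulus.
Variable R : realType.
Implicit Types z w : R[i].

(** Differentiability at each point gives no continuity of the derivatives, so Stokes' theorem for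
    smooth forms is out of reach; dyadic grids take its place. The discretized flux of a box is
    exactly the average of the fluxes of its children, so smallness has to be checked only near each
    point, and a nontrivial character has mean exactly 0 on every fine enough grid. The shrinking of
    the torus stops at [s = eps], because the field carries a factor $1/s$; the gap is closed by
    continuity of f at z together with Cauchy's formula for constants, which is orthogonality of
    characters. Measurability passes to pointwise limits, so it suffices that the Riemann sums
    converge for each $\omega$ separately. One family of coefficients must serve all z, hence they
    are taken at the fixed radius 1/2; the expansion at z, however, uses a radius above every
    $|z_j|$, which is why independence of the radius matters. *)

Definition modc z : R := Normc.normc z.

Lemma normc_modc z : `|z| = (modc z)%:C.
Proof. by []. Qed.

Lemma modcD z w : modc (z + w) <= modc z + modc w.
Proof. exact: le_normcD. Qed.

Lemma modcN z : modc (- z) = modc z.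
Proof. exact: (@normcN R). Qed.

Lemma modcB z w : modc (z - w) <= modc z + modc w.
Proof. by rewrite -(modcN w) modcD. Qed.

Lemma modc_distC z w : modc (z - w) = modc (w - z).
Proof. by rewrite -modcN opprB. Qed.

Lemma modcM z w : modc (z * w) = modc z * modc w.
Proof. exact: Normc.normcM. Qed.

Lemma modcV z : modc z^-1 = (modc z)^-1.
Proof. exact: Normc.normcV. Qed.

Lemma modc_ge0 z : 0 <= modc z.
Proof. by case: z => a b; rewrite /modc /= sqrtr_ge0. Qed.

Lemma modc0 : modc 0 = 0.
Proof. exact: (@Normc.normc0 R). Qed.

Lemma modc1 : modc 1 = 1.
Proof. exact: (@Normc.normc1 R). Qed.

Lemma modc_eq0 z : (modc z == 0) = (z == 0).
Proof.
apply/eqP/eqP => [/Normc.eq0_normc //|->]; exact: modc0.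
Qed.

Lemma modc_real (x : R) : modc x%:C = `|x|.
Proof. by rewrite /modc /= expr0n /= addr0 sqrtr_sqr. Qed.

Lemma modcX z k : modc (z ^+ k) = modc z ^+ k.
Proof. by elim: k => [|k IH]; rewrite ?expr0 ?modc1 // !exprS modcM IH. Qed.

Lemma modc_prod (J : Type) (r : seq J) (Q : pred J) (F : J -> R[i]) :
  modc (\prod_(j <- r | Q j) F j) = \prod_(j <- r | Q j) modc (F j).
Proof. exact: (big_morph modc modcM modc1). Qed.

Lemma modc_sum (J : Type) (r : seq J) (Q : pred J) (F : J -> R[i]) :
  modc (\sum_(j <- r | Q j) F j) <= \sum_(j <- r | Q j) modc (F j).
Proof.
elim/big_ind2: _ => [|x a y b xa yb|//]; first by rewrite modc0.
exact: le_trans (modcD _ _) (lerD xa yb).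
Qed.

Lemma modc_Re z : `|complex.Re z| <= modc z.
Proof. by rewrite -lecR; exact: normc_ge_Re. Qed.

Lemma modc_Im z : `|complex.Im z| <= modc z.
Proof.
case: z => a b; rewrite /modc /= -sqrtr_sqr ler_sqrt ?addr_ge0 ?sqr_ge0 //.
by rewrite lerDr sqr_ge0.
Qed.

Lemma modc_ReIm z : modc z <= `|complex.Re z| + `|complex.Im z|.
Proof.
case: z => a b; rewrite (_ : a +i* b = a%:C + b%:C * 'i); last by simpc.
apply: le_trans (modcD _ _) _; rewrite modcM !modc_real.
rewrite (_ : modc 'i = 1) ?mulr1 //=; last by rewrite /modc /= expr0n expr1n add0r sqrtr1.
by simpc.
Qed.

End Modulus.

Arguments modc : simpl never.

Section Boxes.
Variables (R : realType) (I : finType).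
Implicit Types x y p : I -> R.

(* Dyadic boxes [x, x + 2^-k]^I are coded by their lower corner and level. *)
Definition side (k : nat) : R := 2^-1 ^+ k.

Definition inbox x k y := forall i, x i <= y i <= x i + side k.

Definition child x k (s : {ffun I -> bool}) : I -> R :=
  fun i => x i + (s i)%:R * side k.+1.

Definition unit_cube y := inbox (fun=> 0) 0 y.

Lemma side_gt0 k : 0 < side k.
Proof. by rewrite exprn_gt0 // invr_gt0 ltr0n. Qed.

Lemma sideS k : side k = side k.+1 + side k.+1.
Proof. by rewrite /side exprS; lra. Qed.

Lemma side_small (d : R) : 0 < d -> exists K, forall k, (K <= k)%N -> side k <= d.
Proof.
move=> d0; exists (Num.bound d^-1) => k Kk.
rewrite /side exprVn -[leRHS]invrK lef_pV2 ?posrE ?exprn_gt0 ?invr_gt0 //.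
apply: ltW; apply: lt_trans (archi_boundP _) _; first by rewrite invr_ge0 ltW.
rewrite -natrX ltr_nat; apply: leq_ltn_trans Kk _; exact: ltn_expl.
Qed.

Lemma child_inbox x k s y : inbox (child x k s) k.+1 y -> inbox x k y.
Proof.
move=> H i; move: (H i); rewrite /child (sideS k) => /andP[H1 H2].
have := side_gt0 k.+1; case: (s i) H1 H2 => /= ? ? ?; apply/andP; split; lra.
Qed.

Lemma inbox_child x k y : inbox x k y -> exists s, inbox (child x k s) k.+1 y.
Proof.
move=> H; exists [ffun i => x i + side k.+1 <= y i] => i.
rewrite /child ffunE; move: (H i); rewrite (sideS k).
by case: (leP (x i + side k.+1) (y i)) => /= ? /andP[? ?]; apply/andP; split; lra.
Qed.

(** Compactness of the cube as an induction principle: if [P] failed for the cube, it would fail for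
    some child, then for a child of that child, and so on; these nested boxes share a point [p], and
    the local hypothesis at [p] contradicts failure on small boxes. *)
Lemma bisection (P : (I -> R) -> nat -> Prop) :
  (forall x k, (forall s, P (child x k s) k.+1) -> P x k) ->
  (forall p, unit_cube p ->
    exists K, forall x k, (K <= k)%N -> inbox x k p -> P x k) ->
  P (fun=> 0) 0.
Proof.
move=> Pchild Ploc; apply: contrapT => nP0.
have /choice[F F_] (b : (I -> R) * nat) :
    exists s, ~ P b.1 b.2 -> ~ P (child b.1 b.2 s) b.2.+1.
  have [Pb|nPb] := pselect (P b.1 b.2); first by exists [ffun=> false].
  apply: contrapT => nex; apply: nPb; apply: Pchild => s; apply: contrapT => nPs.
  by apply: nex; exists s.
pose X := fix X k := if k is k'.+1 then child (X k') k' (F (X k', k'))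
                     else (fun=> 0) : I -> R.
have nPX k : ~ P (X k) k by elim: k => [//|k IH]; exact: (F_ (X k, k)).
have Xle k j i : X k i <= X (k + j)%N i /\ X (k + j)%N i + side (k + j) <= X k i + side k.
  elim: j => [|j [IH1 IH2]]; first by rewrite addn0.
  rewrite addnS /= /child; have := sideS (k + j); have := side_gt0 (k + j).+1.
  by case: (F _ i) => /= ? ?; split; lra.
have Xub i k j : X j i <= X k i + side k.
  have [kj|/ltnW jk] := leqP k j.
    by have [_] := Xle k (j - k)%N i; rewrite subnKC //; have := side_gt0 j; lra.
  by have [+ _] := Xle j (k - j)%N i; rewrite subnKC //; have := side_gt0 k; lra.
(* Lower corners increase in every coordinate and stay below every upper corner ([Xub]), so their
   supremum lies in all the boxes. *)
pose p i := sup (range (X ^~ i)).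
have pX k : inbox (X k) k p.
  move=> i; apply/andP; split.
    apply: ub_le_sup; last by exists k.
    by exists (X 0%N i + side 0) => _ [j _ <-].
  by apply: ge_sup => [|_ [j _ <-]//]; exists (X 0%N i), 0%N.
have [K HK] := Ploc p (pX 0%N).
exact: nPX (HK (X K) K (leqnn K) (pX K)).
Qed.
End Boxes.

(** * Dyadic Riemann means *)

Section Mean.
Variables (R : realType) (I : finType).
Implicit Types (x y p : I -> R) (g h : (I -> R) -> R[i]).

Definition avg (F : {ffun I -> bool} -> R[i]) : R[i] :=
  (\sum_s F s) / #|{ffun I -> bool}|%:R.

Let card_gt0 : (0 < #|{ffun I -> bool}|)%N.
Proof. by apply/card_gt0P; exists [ffun=> false]. Qed.

Lemma eq_avg F G : F =1 G -> avg F = avg G.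
Proof. by move=> FG; rewrite /avg (eq_bigr G). Qed.

Lemma avgD F G : avg (fun s => F s + G s) = avg F + avg G.
Proof. by rewrite /avg big_split mulrDl. Qed.

Lemma avgZ a F : avg (fun s => a * F s) = a * avg F.
Proof. by rewrite /avg -mulr_sumr mulrA. Qed.

Lemma avg_cst a : avg (fun=> a) = a.
Proof.
rewrite /avg sumr_const -[X in X / _]mulr_natr mulfK // pnatr_eq0 -lt0n.
exact: card_gt0.
Qed.

Lemma avg_sum (J : Type) (r : seq J) (F : J -> {ffun I -> bool} -> R[i]) :
  avg (fun s => \sum_(j <- r) F j s) = \sum_(j <- r) avg (F j).
Proof. by rewrite /avg exchange_big mulr_suml. Qed.

Lemma avg_le F B : (forall s, modc (F s) <= B) -> modc (avg F) <= B.
Proof.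
move=> FB; rewrite /avg modcM modcV.
rewrite (_ : modc _%:R = #|{ffun I -> bool}|%:R :> R); last first.
  by rewrite -(rmorph_nat (real_complex R)) modc_real ger0_norm.
rewrite ler_pdivrMr ?ltr0n //; apply: le_trans (modc_sum _ _ _) _.
apply: le_trans (ler_sum _ (fun s _ => FB s)) _.
by rewrite sumr_const mulr_natr.
Qed.

(** Exchanges the two halves of a box in direction [i]. Averages over children are computed by
    pairing mirror children, both for the flux and for characters. *)
Definition flip (i : I) (s : {ffun I -> bool}) : {ffun I -> bool} :=
  [ffun j => (j == i) (+) s j].

Lemma flipK i : involutive (flip i).
Proof. by move=> s; apply/ffunP => j; rewrite !ffunE addbA addbb. Qed.

Lemma avg_flip i F : avg (fun s => F (flip i s)) = avg F.
Proof. by rewrite /avg [in RHS](reindex_inj (inv_inj (flipK i))). Qed.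

(* The mean of g over the 2^(N * #|I|) lower corners of the level k + N boxes
   contained in the box (x, k), as a recursion on subdivision. *)
Fixpoint mean N x k g : R[i] :=
  if N is N'.+1 then avg (fun s => mean N' (child x k s) k.+1 g) else g x.

Lemma inbox_corner x k : inbox x k x.
Proof. by move=> i; rewrite lexx lerDl ltW // side_gt0. Qed.

Lemma eq_mean N x k g h : (forall y, inbox x k y -> g y = h y) ->
  mean N x k g = mean N x k h.
Proof.
elim: N x k => [|N IH] x k gh /=; first exact/gh/inbox_corner.
by apply: eq_avg => s; apply: IH => y /child_inbox; exact: gh.
Qed.

Lemma mean_le N x k g B : (forall y, inbox x k y -> modc (g y) <= B) ->
  modc (mean N x k g) <= B.
Proof.
elim: N x k => [|N IH] x k gB /=; first exact/gB/inbox_corner.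
by apply: avg_le => s; apply: IH => y /child_inbox; exact: gB.
Qed.

Lemma meanD N x k g h :
  mean N x k (fun y => g y + h y) = mean N x k g + mean N x k h.
Proof.
by elim: N x k => [//|N IH] x k /=; rewrite -avgD; apply: eq_avg => s.
Qed.

Lemma meanZ N x k a g : mean N x k (fun y => a * g y) = a * mean N x k g.
Proof.
by elim: N x k => [//|N IH] x k /=; rewrite -avgZ; apply: eq_avg => s.
Qed.

Lemma meanB N x k g h :
  mean N x k (fun y => g y - h y) = mean N x k g - mean N x k h.
Proof.
rewrite meanD; congr (_ + _); rewrite -mulN1r -meanZ.
by apply: eq_mean => y _; rewrite mulN1r.
Qed.

Lemma mean_cst N x k a : mean N x k (fun=> a) = a.
Proof.
elim: N x k => [//|N IH] x k /=; rewrite -[RHS]avg_cst.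
exact: eq_avg.
Qed.

Lemma mean_sum N x k (J : Type) (r : seq J) (G : J -> (I -> R) -> R[i]) :
  mean N x k (fun y => \sum_(j <- r) G j y) = \sum_(j <- r) mean N x k (G j).
Proof.
by elim: N x k => [//|N IH] x k /=; rewrite -avg_sum; apply: eq_avg => s.
Qed.

Definition indep (i : I) (T : Type) (g : (I -> R) -> T) :=
  forall y y', (forall j, j != i -> y j = y' j) -> g y = g y'.

Lemma mean_indep i N k g : indep i g -> indep i (fun x => mean N x k g).
Proof.
move=> gi; elim: N k => [|N IH] k x x' xx' /=; first exact: gi.
by apply: eq_avg => s; apply: IH => j ji; rewrite /child xx'.
Qed.

(** An average of quantities bounded by [e] is bounded by [e], so bounds pass from children to
    parent and [bisection] applies. The depth [N0] is uniform in [d], which is the offset between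
    two Riemann sums in the Cauchy criterion and a dummy for the flux. *)
Lemma subdivision_limit (D : Type) (Psi : D -> nat -> (I -> R) -> nat -> R[i]) :
  (forall d N x k, Psi d N.+1 x k = avg (fun s => Psi d N (child x k s) k.+1)) ->
  (forall e, 0 < e -> forall p, unit_cube p ->
    exists K, forall x k, (K <= k)%N -> inbox x k p ->
      forall d N, modc (Psi d N x k) <= e) ->
  forall e, 0 < e -> exists N0, forall N, (N0 <= N)%N ->
    forall d, modc (Psi d N (fun=> 0) 0) <= e.
Proof.
move=> PsiS Ploc e e0.
apply: (@bisection _ _ (fun x k => exists N0, forall N, (N0 <= N)%N ->
    forall d, modc (Psi d N x k) <= e)).
  move=> x k /choice[N_ N_P]; exists (\max_s N_ s).+1 => -[//|N] HN d.
  rewrite PsiS; apply: avg_le => s; apply: N_P.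
  exact: leq_trans (leq_bigmax s) HN.
move=> p /(Ploc e e0)[K HK]; exists K => x k Kk xp; exists 0%N => N _ d.
exact: HK.
Qed.

Definition cont_at g p := forall e, 0 < e -> exists2 d : R, 0 < d &
  forall y, (forall i, `|y i - p i| <= d) -> modc (g y - g p) <= e.

Lemma inbox_dist x k p y i : inbox x k p -> inbox x k y -> `|y i - p i| <= side R k.
Proof.
by move=> /(_ i)/andP[? ?] /(_ i)/andP[? ?]; rewrite ler_norml; apply/andP; split; lra.
Qed.

(** In a small box around [p] both means are within [e / 2] of [g p]; the subdivision argument then
    does the work of uniform continuity. *)
Lemma mean_cauchy g : (forall p, unit_cube p -> cont_at g p) ->
  forall e, 0 < e -> exists N0, forall N, (N0 <= N)%N -> forall d,
    modc (mean (N + d) (fun=> 0) 0 g - mean N (fun=> 0) 0 g) <= e.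
Proof.
move=> gc; apply: (@subdivision_limit nat
  (fun d N x k => mean (N + d) x k g - mean N x k g)) => [d N x k|e e0 p pc].
  rewrite addSn /= -mulN1r -avgZ -avgD; apply: eq_avg => s.
  by rewrite mulN1r.
have [d d0 Hd] := gc p pc (e / 2) (divr_gt0 e0 (ltr0Sn _ _)).
have [K HK] := side_small d0; exists K => x k Kk xp m N.
rewrite (_ : _ - _ = mean (N + m) x k (fun y => g y - g p)
                   - mean N x k (fun y => g y - g p)); last first.
  by rewrite !meanB !mean_cst; ring.
apply: le_trans (modcB _ _) _; rewrite (_ : e = e / 2 + e / 2); last by field.
by apply: lerD; apply: mean_le => y xy; apply: Hd => i;
  apply: le_trans (inbox_dist i xp xy) (HK _ Kk).
Qed.

Lemma cube_bounded g : (forall p, unit_cube p -> cont_at g p) ->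
  exists2 B, 0 <= B & forall y, unit_cube y -> modc (g y) <= B.
Proof.
move=> gc; apply: (@bisection _ _ (fun x k => exists2 B, 0 <= B &
  forall y, inbox x k y -> modc (g y) <= B)).
  move=> x k H; have /choice[B_ HB] s : exists B, 0 <= B /\
      forall y, inbox (child x k s) k.+1 y -> modc (g y) <= B.
    by have [B B0 HB] := H s; exists B.
  exists (\sum_s B_ s); first by apply: sumr_ge0 => s _; case: (HB s).
  move=> y /inbox_child[s /(HB s).2] /le_trans; apply.
  rewrite (bigD1 s) //= lerDl; apply: sumr_ge0 => t _; by case: (HB t).
move=> p pc; have [d d0 Hd] := gc p pc 1 ltr01.
have [K HK] := side_small d0; exists K => x k Kk xp.
exists (modc (g p) + 1); first by rewrite addr_ge0 ?modc_ge0.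
move=> y xy; rewrite -[g y](subrK (g p)) addrC.
apply: le_trans (modcD _ _) _; rewrite lerD2l; apply: Hd => i.
exact: le_trans (inbox_dist i xp xy) (HK _ Kk).
Qed.

End Mean.

(** * Goursat's argument for divergence-free fields *)

Section Continuity.
Variables (R : realType) (I : finType) (p : I -> R).
Implicit Types (g h : (I -> R) -> R[i]).

Lemma cont_cst a : cont_at (fun=> a) p.
Proof. by move=> e e0; exists 1 => // y _; rewrite subrr modc0 ltW. Qed.

Lemma eq_cont g h : g =1 h -> cont_at g p -> cont_at h p.
Proof. by move=> /funext ->. Qed.

Lemma cont_comp2 g h (op : R[i] -> R[i] -> R[i]) :
  (forall e, 0 < e -> exists2 d : R, 0 < d & forall a b,
     modc (a - g p) <= d -> modc (b - h p) <= d ->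
     modc (op a b - op (g p) (h p)) <= e) ->
  cont_at g p -> cont_at h p -> cont_at (fun y => op (g y) (h y)) p.
Proof.
move=> opc gc hc e e0; have [d d0 Hd] := opc e e0.
have [d1 d10 H1] := gc d d0; have [d2 d20 H2] := hc d d0.
exists (Num.min d1 d2) => [|y Hy]; first by rewrite lt_min d10.
by apply: Hd; [apply: H1|apply: H2] => i; have := Hy i; rewrite le_min => /andP[].
Qed.

Lemma contM g h : cont_at g p -> cont_at h p -> cont_at (fun y => g y * h y) p.
Proof.
apply: cont_comp2 => e e0.
have g0 := modc_ge0 (g p); have h0 := modc_ge0 (h p).
have D0 : 0 < modc (g p) + modc (h p) + 1 by lra.
exists (Num.min 1 (e / (modc (g p) + modc (h p) + 1))) => [|a b].
  by rewrite lt_min ltr01 divr_gt0.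
set d := Num.min _ _ => Ha Hb.
have d1 : d <= 1 by rewrite ge_min lexx.
have de : d * (modc (g p) + modc (h p) + 1) <= e.
  by rewrite -ler_pdivlMr // ge_min lexx orbT.
rewrite (_ : _ - _ = (a - g p) * (b - h p) + (a - g p) * h p + g p * (b - h p)); last by ring.
apply: le_trans (modcD _ _) _; apply: le_trans (lerD (modcD _ _) (lexx _)) _.
rewrite !modcM; apply: le_trans de.
have d0 := le_trans (modc_ge0 _) Ha.
have : modc (a - g p) * modc (b - h p) <= d * 1.
  by apply: ler_pM; rewrite ?modc_ge0 //; exact: le_trans Hb d1.
have : modc (a - g p) * modc (h p) <= d * modc (h p) by apply: ler_wpM2r.
have : modc (g p) * modc (b - h p) <= modc (g p) * d by apply: ler_wpM2l.
lra.
Qed.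

Lemma contD g h : cont_at g p -> cont_at h p -> cont_at (fun y => g y + h y) p.
Proof.
apply: cont_comp2 => e e0; exists (e / 2) => [|a b Ha Hb]; first by rewrite divr_gt0.
rewrite opprD addrACA; apply: le_trans (modcD _ _) _; lra.
Qed.

Lemma contV g : g p != 0 -> cont_at g p -> cont_at (fun y => (g y)^-1) p.
Proof.
move=> gp gc; apply: (cont_comp2 (op := fun a _ => a^-1) _ gc gc) => e e0.
have m0 : 0 < modc (g p) by rewrite lt_def modc_ge0 modc_eq0 gp.
exists (Num.min (modc (g p) / 2) (e * modc (g p) ^+ 2 / 2)).
  by rewrite lt_min !divr_gt0 // mulr_gt0 // exprn_gt0.
move=> a b; rewrite le_min => /andP[H1 H2] _ /=.
have ma : modc (g p) / 2 <= modc a.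
  have := modcD (a - g p) (- a); rewrite addrAC subrr add0r !modcN; lra.
have a0 : a != 0 by rewrite -modc_eq0 gt_eqF //; lra.
rewrite (_ : a^-1 - (g p)^-1 = - (a - g p) / (a * g p)); last by field; apply/andP.
rewrite modcM modcN modcV modcM ler_pdivrMr ?mulr_gt0 //; last by lra.
apply: le_trans H2 _; rewrite -mulrA ler_pM2l // expr2 -mulrA.
by rewrite [leRHS]mulrC ler_pM2l.
Qed.

Lemma cont_prod (J : Type) (r : seq J) (Q : pred J) (G : J -> (I -> R) -> R[i]) :
  (forall j, Q j -> cont_at (G j) p) ->
  cont_at (fun y => \prod_(j <- r | Q j) G j y) p.
Proof.
move=> Gc; elim: r => [|j r IH].
  by apply: eq_cont (@cont_cst 1) => y; rewrite big_nil.
have [Qj|nQj] := boolP (Q j).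
  by apply: eq_cont (contM (Gc j Qj) IH) => y; rewrite big_cons Qj.
by apply: eq_cont IH => y; rewrite big_cons (negPf nQj).
Qed.

Lemma contX g k : cont_at g p -> cont_at (fun y => g y ^+ k) p.
Proof.
move=> gc; elim: k => [|k IH].
  exact: eq_cont (@cont_cst 1).
by apply: eq_cont (contM gc IH) => y; rewrite exprS.
Qed.

End Continuity.

(** * Flux through the faces of dyadic boxes *)

Section Flux.
Variables (R : realType) (I : finType).
Implicit Types (x y p : I -> R) (G : (I -> R) -> R[i]) (c : I -> R[i]).
Implicit Types (w : I -> (I -> R) -> R[i]).

Definition upd y (i : I) (a : R) : I -> R := fun j => if j == i then a else y j.

(** The scale [eta] is any common bound on the increments rather than their sup norm, so the side of
    a box or a Lipschitz bound can be inserted directly. *)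
Definition real_diff_at G p c := forall e, 0 < e -> exists2 d : R, 0 < d &
  forall eta v, 0 <= eta <= d -> (forall i, `|v i| <= eta) ->
  modc (G (fun i => p i + v i) - G p - \sum_i c i * (v i)%:C) <= e * eta.

(* Discretized flux through the faces of the box (x, k), per unit volume, of
   the vector field with components w i * G. *)
Definition flux w G N x k : R[i] :=
  \sum_i ((side R k)^-1)%:C *
    mean N x k (fun y => w i y * (G (upd y i (x i + side R k)) - G (upd y i (x i)))).

(** Fluxes through interior faces cancel: in direction [i] a child and its mirror image share the
    middle face, so their differences telescope to the difference across the parent. The side
    halves, and the resulting factor 2 makes up for averaging over the pair. *)
Lemma flux_subdivide w G N x k : (forall i, indep i (w i)) ->
  flux w G N.+1 x k = avg (fun s => flux w G N (child x k s) k.+1).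
Proof.
move=> wi; rewrite /flux avg_sum; apply: eq_bigr => i _.
(* [A t s] is taken on the face [t] half-sides above the lower corner of the parent; child [s] lies
   between the faces [s i] and [s i + 1]. *)
pose A (t : nat) (s : {ffun I -> bool}) := mean N (child x k s) k.+1
  (fun y => w i y * G (upd y i (x i + t%:R * side R k.+1))).
have Aflip t s : A t (flip i s) = A t s.
  apply: (@mean_indep _ _ i) => [y y' yy'|j ji].
    rewrite (wi i y y' yy'); congr (_ * G _); apply/funext => j.
    by rewrite /upd; case: eqVneq => // /yy'.
  by rewrite /child ffunE (negPf ji).
pose D (s : {ffun I -> bool}) := A (s i).+1 s - A (s i) s.
have Dflip s : D s + D (flip i s) = A 2%N s - A 0%N s.
  rewrite /D !Aflip ffunE eqxx; case: (s i) => /=; ring.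
rewrite (_ : avg _ = avg (fun s => ((side R k.+1)^-1)%:C * D s)); last first.
  apply: eq_avg => s; congr (_ * _); rewrite /D /A -meanB.
  apply: eq_mean => y _; rewrite -mulrBr; congr (_ * (G (upd _ _ _) - G _)).
  by rewrite /child; case: (s i) => /=; ring.
rewrite avgZ (_ : mean _ _ _ _ = avg (fun s => D s + D (flip i s))); last first.
  apply: eq_avg => s; rewrite Dflip -meanB; apply: eq_mean => y _.
  rewrite -mulrBr mul0r addr0; congr (_ * (G (upd _ _ _) - _)).
  by rewrite (sideS R k); ring.
rewrite avgD (avg_flip i D) (_ : (side R k.+1)^-1 = 2 * (side R k)^-1); last first.
  have -> : side R k = 2 * side R k.+1 by rewrite (sideS R k); ring.
  by rewrite invfM mulrA divff ?mul1r ?pnatr_eq0.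
by rewrite rmorphM rmorph_nat; ring.
Qed.

(** On both faces [G] equals its affine approximation at [p] up to a small multiple of the side, so
    dividing the difference by the side leaves [c i] and a small error. *)
Lemma flux_density w G p c i : cont_at (w i) p -> real_diff_at G p c ->
  forall e, 0 < e -> exists K, forall x k, (K <= k)%N -> inbox x k p -> forall N,
    modc (((side R k)^-1)%:C * mean N x k (fun y =>
      w i y * (G (upd y i (x i + side R k)) - G (upd y i (x i)))) - w i p * c i) <= e.
Proof.
move=> wc Gd e e0.
have c0 := modc_ge0 (c i); have w0 := modc_ge0 (w i p).
(* [e1] controls the variation of the weight times [c i]. [e2] controls the difference quotient,
   whose error is at most [2 * e2] (one [e2] per face) times a weight at most [modc (w i p) + 1].
   Each costs at most [e / 2]. *)
pose e1 := Num.min 1 (e / 2 / (modc (c i) + 1)).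
have e1_gt0 : 0 < e1 by rewrite lt_min ltr01 !divr_gt0 //; lra.
pose e2 := e / (4 * (modc (w i p) + 1)).
have e2_gt0 : 0 < e2 by rewrite divr_gt0 //; lra.
have [d1 d10 H1] := wc e1 e1_gt0; have [d2 d20 H2] := Gd e2 e2_gt0.
have [K1 HK1] := side_small d10; have [K2 HK2] := side_small d20.
exists (maxn K1 K2) => x k; rewrite geq_max => /andP[/HK1 k1 /HK2 k2] xp N.
set h := side R k in k1 k2 *; have h0 : 0 < h := side_gt0 R k.
rewrite -meanZ -(mean_cst N x k (w i p * c i)) -meanB; apply: mean_le => y xy.
have yp j : `|y j - p j| <= h by exact: inbox_dist xp xy.
have near (a : R) : x i <= a <= x i + h ->
    modc (G (upd y i a) - G p - \sum_j c j * (upd y i a j - p j)%:C) <= e2 * h.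
  move=> ax; have := H2 h (fun j => upd y i a j - p j); rewrite ltW // k2 => /(_ isT).
  rewrite (_ : (fun j => p j + _) = upd y i a); last by apply/funext => j; ring.
  apply=> j; rewrite /upd; case: eqP => [->|//].
  move: ax (xp i); rewrite -/h => /andP[? ?] /andP[? ?].
  by rewrite ler_norml; apply/andP; split; lra.
have := near (x i + h) _; rewrite lexx lerDl ltW // => /(_ isT) n1.
have := near (x i) _; rewrite lexx lerDl ltW // => /(_ isT) n2.
set S1 := \sum_j _ in n1; set S2 := \sum_j _ in n2.
have S12 : S1 - S2 = c i * h%:C.
  rewrite /S1 /S2 -sumrB (bigD1 i) //= big1 => [|j /negPf ji].
    by rewrite /upd eqxx addr0 -mulrBr -rmorphB /=; congr (_ * _%:C); ring.
  by rewrite /upd ji subrr.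
set u := G _ - G p - S1 in n1; set v := G _ - G p - S2 in n2.
have -> : G (upd y i (x i + h)) - G (upd y i (x i)) = (u - v) + c i * h%:C.
  by rewrite -S12 /u /v; ring.
have hC : h%:C != 0 :> R[i] by rewrite (inj_eq (fmorph_inj (real_complex R))) gt_eqF.
rewrite fmorphV (_ : _ - _ = (w i y - w i p) * c i + w i y * ((u - v) / h%:C)); last by field.
have W := H1 y (fun j => le_trans (yp j) k1).
have e11 : e1 <= 1 by rewrite ge_min lexx.
have wy : modc (w i y) <= modc (w i p) + 1.
  by have := modcD (w i y - w i p) (w i p); rewrite subrK; lra.
have uv : modc ((u - v) / h%:C) <= 2 * e2.
  rewrite modcM modcV modc_real gtr0_norm // ler_pdivrMr //.
  apply: le_trans (modcB _ _) _; lra.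
apply: le_trans (modcD _ _) _; rewrite !modcM.
have : modc (w i y - w i p) * modc (c i) <= e1 * modc (c i) by apply: ler_wpM2r.
have : e1 * (modc (c i) + 1) <= e / 2 by rewrite -ler_pdivlMr ?ge_min ?lexx ?orbT //; lra.
have : modc (w i y) * modc ((u - v) / h%:C) <= (modc (w i p) + 1) * (2 * e2).
  by apply: ler_pM; rewrite ?modc_ge0.
have -> : (modc (w i p) + 1) * (2 * e2) = e / 2 by rewrite /e2; field; lra.
by rewrite modcM; lra.
Qed.

(* Goursat's argument for the divergence theorem: only differentiability is
   needed, because a divergence-free field has infinitesimal flux per unit
   volume near each point. *)
Theorem flux_limit w G : (forall i, indep i (w i)) ->
  (forall p, unit_cube p -> (forall i, cont_at (w i) p) /\
     exists2 c, real_diff_at G p c & \sum_i w i p * c i = 0) ->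
  forall e, 0 < e -> exists N0, forall N, (N0 <= N)%N ->
    modc (\sum_i mean N (fun=> 0) 0 (fun y => w i y * (G (upd y i 1) - G (upd y i 0)))) <= e.
Proof.
move=> wi H e e0.
have [|e' e'0 p pc|N0 HN0] := @subdivision_limit R I unit (fun=> flux w G) _ _ e e0.
  by move=> _ N x k; apply: flux_subdivide.
  have [wc [c cG c0]] := H p pc.
  pose e1 := e' / #|I|.+1%:R.
  have e10 : 0 < e1 by rewrite divr_gt0.
  have /choice[K_ HK_] i := flux_density (wc i) cG e10.
  exists (\max_i K_ i) => x k Kk xp _ N.
  (* Subtracting the vanishing divergence compares each direction with its own limit density. *)
  rewrite -[flux _ _ _ _ _]subr0 -c0 /flux -sumrB.
  apply: le_trans (modc_sum _ _ _) _.
  apply: le_trans (ler_sum _ (fun i _ => HK_ i x k (leq_trans (leq_bigmax i) Kk) xp N)) _.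
  rewrite sumr_const -mulr_natr -mulrA ler_piMr ?(ltW e'0) //.
  by rewrite ler_pdivrMl ?ltr0n // mulr1 ler_nat; exact: leqnSn.
exists N0 => N /HN0 /(_ tt); rewrite /flux (_ : side R 0 = 1) ?expr0 // invr1.
by under eq_bigr do rewrite mul1r add0r.
Qed.

End Flux.

(** * Points of the unit circle *)

Section Circle.
Import numFieldNormedType.Exports.
Variable R : realType.
Implicit Types t h : R.

(** $e^{2\pi i t}$: angles are counted in full turns, so that the unit cube parametrizes the torus
    and dyadic steps give roots of unity. *)
Definition cis t : R[i] := cos (2 * pi * t) +i* sin (2 * pi * t).

Lemma cisD t h : cis (t + h) = cis t * cis h.
Proof. by rewrite /cis mulrDr cosD sinD; simpc; congr (_ +i* _); ring. Qed.

Lemma cis0 : cis 0 = 1.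
Proof. by rewrite /cis mulr0 cos0 sin0. Qed.

Lemma cis1 : cis 1 = 1.
Proof.
by rewrite /cis mulr1 (_ : 2 * pi = pi *+ 2) ?cos2pi ?sin2pi // mulr_natl.
Qed.

Lemma cis_half : cis 2^-1 = -1.
Proof.
rewrite /cis (_ : 2 * pi * 2^-1 = pi) ?cospi ?sinpi; last by field.
by apply/eqP; rewrite eq_complex /= oppr0 !eqxx.
Qed.

Lemma modc_cis t : modc (cis t) = 1.
Proof. by rewrite /modc /= cos2Dsin2 sqrtr1. Qed.

Lemma cis_neq0 t : cis t != 0.
Proof. by rewrite -modc_eq0 modc_cis oner_neq0. Qed.

(** Write $k = 2^v u$ with $u$ odd: $k$ steps of $2^{-(v+1)}$ make $u$ half-turns. The induction
    halves [k] until it is odd. *)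
Lemma cis_side_root k : (0 < k)%N ->
  exists2 j, (0 < j)%N & cis (side R j) ^+ k = -1.
Proof.
elim/ltn_ind: k => k IH k0; have [ok|ek] := boolP (odd k).
  exists 1%N => //; rewrite /side expr1 cis_half -signr_odd ok expr1 //.
have kE : k = (2 * k./2)%N by rewrite mul2n even_halfK.
have [||j j0 Hj] := IH k./2; [lia|lia|].
by exists j.+1 => //; rewrite kE exprM expr2 -cisD -sideS.
Qed.

Lemma cis_separate (a b : nat) : a != b ->
  exists2 j, (0 < j)%N & cis (side R j) ^+ a * (cis (side R j))^-1 ^+ b = -1.
Proof.
have sep c k : (0 < k)%N -> exists2 j, (0 < j)%N &
    cis (side R j) ^+ (c + k) * (cis (side R j))^-1 ^+ c = -1.
  move=> /cis_side_root[j j0 Hj]; exists j => //.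
  by rewrite exprD Hj exprVn mulrAC divff ?mul1r // expf_neq0 // cis_neq0.
have [lt_ab|lt_ba|->] := ltngtP a b; last by [].
- have [|j j0 Hj] := sep a (b - a)%N; first by rewrite subn_gt0.
  exists j => //; rewrite subnKC ?(ltnW lt_ab) // in Hj.
  apply: (@invr_inj R[i]); rewrite invrM ?unitfE ?expf_neq0 ?invr_eq0 ?cis_neq0 //.
  by rewrite -!exprVn invrK Hj invrN invr1.
- have [|j j0 Hj] := sep b (a - b)%N; first by rewrite subn_gt0.
  by exists j => //; rewrite subnKC ?(ltnW lt_ba) // in Hj.
Qed.

Lemma is_derive_eps (f : R -> R) (x df : R) : is_derive x (1 : R) f df ->
  forall e, 0 < e -> exists2 d : R, 0 < d &
    forall h, `|h| <= d -> `|f (x + h) - f x - df * h| <= e * `|h|.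
Proof.
move=> fdf e e0; have [fx dfE] := fdf.
have /cvgrPdist_le /(_ e e0) :
    (h^-1 *: (f (h *: 1 + x) - f x) @[h --> 0^'] --> df)%classic.
  by rewrite -dfE; exact: fx.
move=> /nbhs_ballP[d /= d0 Hd]; exists (d / 2) => [|h hd]; first by rewrite divr_gt0.
have [->|hn0] := eqVneq h 0; first by rewrite addr0 mulr0 subrr subr0 normr0 mulr0.
have hlt : `|h| < d by lra.
have := Hd h; rewrite /ball /= sub0r normrN => /(_ hlt hn0) Hh.
rewrite (_ : _ - _ = - (df - h^-1 *: (f (h *: 1 + x) - f x)) * h).
  by rewrite normrM normrN ler_wpM2r.
rewrite /GRing.scale /= mulr1 [h + x]addrC; field.
exact: hn0.
Qed.

Lemma cis_derivative t e : 0 < e -> exists2 d : R, 0 < d & forall h, `|h| <= d ->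
  modc (cis (t + h) - cis t - (2 * pi)%:C * 'i * cis t * h%:C) <= e * `|h|.
Proof.
move=> e0.
have pi0 : 0 < 2 * pi :> R by rewrite mulr_gt0 // pi_gt0.
have e10 : 0 < e / 2 / (2 * pi) by rewrite !divr_gt0.
have [d1 d10 H1] := is_derive_eps (is_derive_cos (0 : R)) e10.
have [d2 d20 H2] := is_derive_eps (is_derive_sin (0 : R)) e10.
exists (Num.min d1 d2 / (2 * pi)) => [|h hd].
  by rewrite divr_gt0 // lt_min d10.
have {hd} : `|2 * pi * h| <= Num.min d1 d2.
  by rewrite normrM (gtr0_norm pi0) mulrC -ler_pdivlMr.
rewrite le_min => /andP[/H1 + /H2].
rewrite !add0r cos0 sin0 oppr0 mul0r !subr0 mul1r.
rewrite normrM (gtr0_norm pi0) mulrA divfK ?gt_eqF // => hc hs.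
rewrite cisD (_ : _ - _ - _ = cis t * (cis h - 1 - (2 * pi)%:C * 'i * h%:C)); last by ring.
rewrite modcM modc_cis mul1r; apply: le_trans (modc_ReIm _) _.
rewrite /cis; simpc; rewrite /=; move: hs; rewrite addr0 => hs; lra.
Qed.

End Circle.

(** * Characters and real differentiability *)

Section Characters.
Variables (R : realType) (I : finType).
Implicit Types (x y v : I -> R).

Lemma mean_shift (chi : (I -> R) -> R[i]) N x v k :
  (forall y v, chi (fun l => y l + v l) = chi y * chi v) ->
  mean N (fun l => x l + v l) k chi = chi v * mean N x k chi.
Proof.
move=> chiD; elim: N x k => [|N IH] x k /=; first by rewrite chiD mulrC.
rewrite -avgZ; apply: eq_avg => s; rewrite -IH; congr mean.
by apply/funext => l; rewrite /child; ring.
Qed.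

(** When the subdivision reaches level [j], mirror children differ by a translation on which [chi]
    is -1, so their means cancel exactly; the condition on [j] says that the recursion does pass
    through that level. *)
Lemma mean_char0 (chi : (I -> R) -> R[i]) i j :
  (forall y v, chi (fun l => y l + v l) = chi y * chi v) ->
  chi (fun l => (l == i)%:R * side R j) = -1 ->
  forall N x k, (k < j <= k + N)%N -> mean N x k chi = 0.
Proof.
move=> chiD chij; elim=> [|N IH] x k; first by lia.
move=> /andP[kj jN] /=; have [kj'|jk] := ltnP k.+1 j.
  by rewrite (eq_avg (G := fun=> 0)) ?avg_cst // => s; apply: IH; lia.
have jE : j = k.+1 by lia.
set F := fun s : {ffun I -> bool} => _.
have Ff (s : {ffun I -> bool}) : s i = false -> F (flip i s) = - F s.
  move=> si; rewrite /F -mulN1r -chij jE -mean_shift //; congr mean.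
  apply/funext => l; rewrite /child /flip ffunE; case: eqVneq => [->|_] /=.
    by rewrite si /=; ring.
  by ring.
have Fflip (s : {ffun I -> bool}) : F (flip i s) = - F s.
  have [si|/negPf/Ff//] := boolP (s i).
  have := Ff (flip i s); rewrite flipK => ->; first by rewrite opprK.
  by rewrite /flip ffunE eqxx si.
have /eqP : avg F = - avg F.
  by rewrite -[LHS](avg_flip i) -mulN1r -avgZ; apply: eq_avg => s; rewrite Fflip mulN1r.
by rewrite -addr_eq0 -mulr2n mulrn_eq0 => /eqP.
Qed.

End Characters.

Section TorusMonomials.
Variables (R : realType) (n : nat).
Implicit Types (y : option 'I_n -> R).

(* Torus coordinates are indexed by [Some l]; the extra coordinate [None] is the
   parameter of the homotopy in the proof of Cauchy's formula, and a dummy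
   elsewhere. *)
Lemma mean_monomial (a b : 'I_n -> nat) : exists N0, forall N, (N0 <= N)%N ->
  mean N (fun=> 0) 0 (fun y =>
    \prod_l (cis (y (Some l)) ^+ a l * (cis (y (Some l)))^-1 ^+ b l)) =
  [forall l, a l == b l]%:R.
Proof.
have [/forallP ab|] := boolP [forall l, a l == b l].
  exists 0%N => N _; rewrite -[RHS](@mean_cst R (option 'I_n) N (fun=> 0) 0).
  apply: eq_mean => y _.
  apply: big1 => l _; rewrite (eqP (ab l)) exprVn divff //.
  by rewrite expf_neq0 // cis_neq0.
rewrite negb_forall => /existsP[l /(cis_separate R)[j j0 Hj]].
exists j => N jN; apply: (@mean_char0 _ _ _ (Some l) j); last by rewrite j0.
  move=> y v; rewrite -big_split; apply: eq_bigr => m _ /=.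
  by rewrite cisD invfM !exprMn; ring.
rewrite (bigD1 l) //= eqxx mul1r Hj big1 ?mulr1 // => m /negPf ml.
by rewrite (_ : (Some m == Some l) = false) ?mul0r ?cis0 ?invr1 ?expr1n ?mulr1.
Qed.

End TorusMonomials.

Section RealDifferentiation.
Variables (R : realType) (I : finType) (p : I -> R).
Implicit Types (G H : (I -> R) -> R[i]) (c : I -> R[i]).

Lemma eq_rdc G c c' : c =1 c' -> real_diff_at G p c -> real_diff_at G p c'.
Proof. by move=> /funext ->. Qed.

Lemma rd_lipschitz G c : real_diff_at G p c -> exists2 L : R, 0 < L &
  exists2 d : R, 0 < d & forall eta v, 0 <= eta <= d -> (forall i, `|v i| <= eta) ->
    modc (G (fun i => p i + v i) - G p) <= L * eta.
Proof.
move=> /(_ 1 ltr01)[d d0 Hd].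
have S0 : 0 <= \sum_i modc (c i) by apply: sumr_ge0 => i _; exact: modc_ge0.
exists (\sum_i modc (c i) + 1); first by lra.
exists d => // eta v hd hv; have := Hd eta v hd hv.
have : modc (\sum_i c i * (v i)%:C) <= (\sum_i modc (c i)) * eta.
  apply: le_trans (modc_sum _ _ _) _; rewrite mulr_suml; apply: ler_sum => i _.
  by rewrite modcM modc_real ler_wpM2l ?modc_ge0.
set S := \sum_i c i * _ => HS H1.
rewrite -[_ - _](subrK S); apply: le_trans (modcD _ _) _; lra.
Qed.

Lemma rd_cont G c : real_diff_at G p c -> cont_at G p.
Proof.
move=> /rd_lipschitz[L L0 [d d0 Hd]] e e0.
exists (Num.min d (e / L)) => [|y Hy]; first by rewrite lt_min d0 divr_gt0.
have := Hd (Num.min d (e / L)) (fun i => y i - p i).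
rewrite (_ : (fun i => p i + _) = y); last by apply/funext => i; ring.
rewrite le_min ge_min lexx (ltW d0) divr_ge0 ?(ltW e0) ?(ltW L0) // => /(_ isT Hy) /le_trans; apply.
by rewrite mulrC -ler_pdivlMr // ge_min lexx orbT.
Qed.

Lemma rd_cst a : real_diff_at (fun=> a) p (fun=> 0).
Proof.
move=> e e0; exists 1 => // eta v /andP[eta0 _] _.
by rewrite subrr big1 ?subrr ?modc0 ?mulr_ge0 ?(ltW e0) // => i _; rewrite mul0r.
Qed.

Lemma rd_coord i : real_diff_at (fun y => (y i)%:C) p (fun j => (j == i)%:R).
Proof.
move=> e e0; exists 1 => // eta v /andP[eta0 _] _.
rewrite (bigD1 i) //= big1 ?eqxx ?mul1r => [|j /negPf ->]; last by rewrite mul0r.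
rewrite rmorphD addr0 (_ : _ - _ - _ = 0); last by ring.
by rewrite modc0 mulr_ge0 ?(ltW e0).
Qed.

Lemma rd_cis i : real_diff_at (fun y => cis (y i)) p
  (fun j => (j == i)%:R * ((2 * pi)%:C * 'i * cis (p i))).
Proof.
move=> e e0; have [d d0 Hd] := cis_derivative (p i) e0.
exists d => // eta v /andP[eta0 etad] hv.
rewrite (bigD1 i) //= big1 ?eqxx ?mul1r ?addr0 => [|j /negPf ->]; last by rewrite !mul0r.
apply: le_trans (Hd _ (le_trans (hv i) etad)) _.
by rewrite ler_wpM2l // ltW.
Qed.

Lemma rdD G H c c' : real_diff_at G p c -> real_diff_at H p c' ->
  real_diff_at (fun y => G y + H y) p (fun i => c i + c' i).
Proof.
move=> Gc Hc e e0; have e20 : 0 < e / 2 by rewrite divr_gt0.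
have [d1 d10 H1] := Gc _ e20; have [d2 d20 H2] := Hc _ e20.
exists (Num.min d1 d2) => [|eta v]; first by rewrite lt_min d10.
rewrite le_min => /and3P[h0 h1 h2] hv.
have {}H1 := H1 eta v; rewrite h0 h1 in H1; have {}H1 := H1 isT hv.
have {}H2 := H2 eta v; rewrite h0 h2 in H2; have {}H2 := H2 isT hv.
under eq_bigr do rewrite mulrDl.
rewrite big_split /=; set a := G _ - _ - _ in H1; set b := H _ - _ - _ in H2.
rewrite (_ : _ - _ = a + b); last by rewrite /a /b; ring.
apply: le_trans (modcD _ _) _; lra.
Qed.

Lemma rdM G H c c' : real_diff_at G p c -> real_diff_at H p c' ->
  real_diff_at (fun y => G y * H y) p (fun i => c i * H p + G p * c' i).
Proof.
move=> Gc Hc e e0.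
have [L1 L10 [d1 d10 H1]] := rd_lipschitz Gc.
have [L2 L20 [d2 d20 H2]] := rd_lipschitz Hc.
have g0 := modc_ge0 (G p); have h0 := modc_ge0 (H p).
(* Linearization errors are weighted by the value of the other factor, and the product of the
   increments is at most [L1 * L2 * (e / M) * eta] once [eta <= e / M]; [M] collects all these
   weights. *)
pose M := modc (G p) + modc (H p) + L1 * L2 + 1.
have M0 : 0 < M by have := mulr_gt0 L10 L20; rewrite /M; lra.
have e10 : 0 < e / M by rewrite divr_gt0.
have [d3 d30 H3] := Gc _ e10; have [d4 d40 H4] := Hc _ e10.
exists (Num.min (Num.min d1 d2) (Num.min (e / M) (Num.min d3 d4))) => [|eta v].
  by rewrite !lt_min d10 d20 d30 d40 e10.
rewrite !le_min => /and3P[eta0 /andP[k1 k2] /and3P[ke k3 k4]] hv.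
have {}H1 := H1 eta v; rewrite eta0 k1 in H1; have {}H1 := H1 isT hv.
have {}H2 := H2 eta v; rewrite eta0 k2 in H2; have {}H2 := H2 isT hv.
have {}H3 := H3 eta v; rewrite eta0 k3 in H3; have {}H3 := H3 isT hv.
have {}H4 := H4 eta v; rewrite eta0 k4 in H4; have {}H4 := H4 isT hv.
rewrite (eq_bigr (fun i => c i * (v i)%:C * H p + G p * (c' i * (v i)%:C))); last first.
  by move=> i _; ring.
rewrite big_split /= -mulr_suml -mulr_sumr.
set S1 := \sum_i _ in H3 *; set S2 := \sum_i _ in H4 *.
set g := G _ in H1 H3 *; set h := H _ in H2 H4 *.
rewrite (_ : _ - _ = (g - G p - S1) * H p + G p * (h - H p - S2)
   + (g - G p) * (h - H p)); last by ring.
apply: le_trans (modcD _ _) _; apply: le_trans (lerD (modcD _ _) (lexx _)) _.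
rewrite !modcM.
have B1 : modc (g - G p - S1) * modc (H p) <= e / M * eta * modc (H p).
  exact: ler_wpM2r.
have B2 : modc (G p) * modc (h - H p - S2) <= modc (G p) * (e / M * eta).
  exact: ler_wpM2l.
have B3 : modc (g - G p) * modc (h - H p) <= (L1 * eta) * (L2 * (e / M)).
  apply: ler_pM; rewrite ?modc_ge0 //; apply: le_trans H2 _.
  by rewrite ler_pM2l.
rewrite (_ : e * eta = e / M * eta * modc (H p) + modc (G p) * (e / M * eta)
  + (L1 * eta) * (L2 * (e / M)) + e / M * eta); last by rewrite /M; field; rewrite -/M; lra.
by have := mulr_ge0 (ltW e10) eta0; lra.
Qed.

(** Chain rule with a complex linearization outside and real ones inside. The increments of [Z] are
    at most [L * eta], so the outer error is taken at that scale; it receives half of [e], the inner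
    errors weighted by [a] the other half. *)
Lemma rd_comp n (f : ('I_n -> R[i]) -> R[i]) (Z : 'I_n -> (I -> R) -> R[i])
    (a : 'I_n -> R[i]) (c : 'I_n -> I -> R[i]) :
  (forall e, 0 < e -> exists2 d : R, 0 < d & forall eta h, 0 <= eta <= d ->
     (forall j, modc (h j) <= eta) ->
     modc (f (fun j => Z j p + h j) - f (Z ^~ p) - \sum_j a j * h j) <= e * eta) ->
  (forall l, real_diff_at (Z l) p (c l)) ->
  real_diff_at (fun y => f (Z ^~ y)) p (fun i => \sum_l a l * c l i).
Proof.
move=> fa Zc e e0.
have /choice[L_ HL] l : exists L, 0 < L /\ exists2 d : R, 0 < d & forall eta v,
    0 <= eta <= d -> (forall i, `|v i| <= eta) ->
    modc (Z l (fun i => p i + v i) - Z l p) <= L * eta.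
  by have [L L0 HL] := rd_lipschitz (Zc l); exists L.
have /choice[d_ Hd] l : exists d, 0 < d /\ forall eta v,
    0 <= eta <= d -> (forall i, `|v i| <= eta) ->
    modc (Z l (fun i => p i + v i) - Z l p) <= L_ l * eta.
  by have [_ [d d0 H]] := HL l; exists d.
pose L := \sum_l L_ l + 1.
have LL l : L_ l <= L.
  rewrite /L (bigD1 l) //= -addrA lerDl addr_ge0 // sumr_ge0 // => m _.
  by rewrite ltW //; case: (HL m).
have L0 : 0 < L.
  by rewrite ltr_wpDl // sumr_ge0 // => m _; rewrite ltW //; case: (HL m).
have [d1 d10 H1] := fa (e / 2 / L) (divr_gt0 (divr_gt0 e0 (ltr0Sn _ _)) L0).
pose A := \sum_l modc (a l) + 1.
have A0 : 0 < A by rewrite ltr_wpDl // sumr_ge0 // => m _; exact: modc_ge0.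
have e10 : 0 < e / 2 / A by rewrite !divr_gt0.
have /choice[k_ Hk] l : exists d, 0 < d /\ forall eta v,
    0 <= eta <= d -> (forall i, `|v i| <= eta) ->
    modc (Z l (fun i => p i + v i) - Z l p - \sum_i c l i * (v i)%:C) <= e / 2 / A * eta.
  by have [d d0 H] := Zc l _ e10; exists d.
pose D := \big[Num.min/(d1 / L)]_l Num.min (d_ l) (k_ l).
have D1 : D <= d1 / L by exact: bigmin_le_id.
have DD l : D <= Num.min (d_ l) (k_ l) by exact: bigmin_le_cond.
exists D.
  apply: lt_bigmin => [|l _]; first by rewrite divr_gt0.
  by rewrite lt_min; case: (Hd l) => ->; case: (Hk l) => ->.
move=> eta v /andP[eta0 etaD] hv.
pose h l := Z l (fun i => p i + v i) - Z l p.
have hL l : modc (h l) <= L * eta.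
  have [_ H] := Hd l; apply: le_trans (H eta v _ hv) (ler_wpM2r eta0 (LL l)).
  by rewrite eta0; apply: le_trans etaD (le_trans (DD l) _); rewrite ge_min lexx.
have := H1 (L * eta) h _ hL.
rewrite (_ : (fun j => Z j p + h j) = Z ^~ (fun i => p i + v i)); last first.
  by apply/funext => j; rewrite /h; ring.
rewrite mulr_ge0 ?(ltW L0) //= mulrC -ler_pdivlMr // (le_trans etaD D1) => /(_ isT).
have -> : e / 2 / L * (eta * L) = e / 2 * eta by field; lra.
set u := _ - _ - _ => Hu.
have -> : f (Z ^~ (fun i => p i + v i)) - f (Z ^~ p)
    - \sum_i (\sum_l a l * c l i) * (v i)%:C
  = u + \sum_l a l * (h l - \sum_i c l i * (v i)%:C).
  have -> : \sum_i (\sum_l a l * c l i) * (v i)%:C =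
      \sum_l a l * \sum_i c l i * (v i)%:C.
    under eq_bigr do rewrite mulr_suml; rewrite exchange_big /=.
    by apply: eq_bigr => l _; rewrite mulr_sumr; apply: eq_bigr => i _; rewrite mulrA.
  rewrite [X in _ = u + X](eq_bigr (fun l => a l * h l - a l * \sum_i c l i * (v i)%:C)).
    by rewrite sumrB /u; ring.
  by move=> l _; rewrite mulrBr.
apply: le_trans (modcD _ _) _.
have : modc (\sum_l a l * (h l - \sum_i c l i * (v i)%:C)) <= \sum_l modc (a l) * (e / 2 / A * eta).
  apply: le_trans (modc_sum _ _ _) _; apply: ler_sum => l _; rewrite modcM.
  apply: ler_wpM2l; rewrite ?modc_ge0 //; apply: (Hk l).2 => //.
  by rewrite eta0; apply: le_trans etaD (le_trans (DD l) _); rewrite ge_min lexx orbT.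
rewrite -mulr_suml => B.
have : e / 2 * eta = (\sum_l modc (a l)) * (e / 2 / A * eta) + e / 2 / A * eta.
  by rewrite /A; field; rewrite -/A; lra.
by have := mulr_ge0 (ltW e10) eta0; lra.
Qed.

End RealDifferentiation.

(** * Cauchy's formula: the homotopy *)

Section CauchyHomotopy.
Variables (R : realType) (n : nat).
Local Notation I := (option 'I_n).
Implicit Types (y p : I -> R) (z : 'I_n -> R[i]) (f : ('I_n -> R[i]) -> R[i]).

Lemma big_option (F : I -> R[i]) : \sum_i F i = F None + \sum_l F (Some l).
Proof.
rewrite (bigD1 None) //=; congr (_ + _).
rewrite (reindex_omap Some id) => [|[l|] //=].
by apply: eq_bigl => l; rewrite /= eqxx.
Qed.

Definition torus (rho : R) y : 'I_n -> R[i] := fun l => rho%:C * cis (y (Some l)).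

(** For $T=\rho e^{2\pi i\theta}$ the form $dT/(2\pi i(T-z))$ becomes $(1-z/T)^{-1}d\theta$. *)
Definition cauchy_factor rho z l y : R[i] := (1 - z l / torus rho y l)^-1.

Definition cauchy_kernel rho z y : R[i] := \prod_l cauchy_factor rho z l y.

Lemma modc_torus rho y l : 0 <= rho -> modc (torus rho y l) = rho.
Proof. by move=> r0; rewrite modcM modc_cis mulr1 modc_real ger0_norm. Qed.

Lemma polydiscP z : polydisc z <-> forall l, modc (z l) < 1.
Proof.
have lt1 (x : R) : (x%:C < 1 :> R[i]) = (x < 1) by rewrite -ltcR.
by split=> H l; have := H l; rewrite normc_modc lt1.
Qed.

Lemma C_differentiable_modc f z : C_differentiable_at f z -> exists c,
  forall e, 0 < e -> exists2 d : R, 0 < d & forall eta h, 0 <= eta <= d ->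
     (forall j, modc (h j) <= eta) ->
     modc (f (fun j => z j + h j) - f z - \sum_j c j * h j) <= e * eta.
Proof.
move=> [c Hc]; exists c => e e0; have [d d0 Hd] := Hc e e0.
exists (d / 2) => [|eta h /andP[eta0 etad] hh]; first by rewrite divr_gt0.
have hd j : `|h j| < d%:C by rewrite normc_modc ltcR; apply: le_lt_trans (hh j) _; lra.
rewrite -lecR; apply: le_trans (Hd h hd) _.
rewrite rmorphM /= ler_wpM2l ?lecR ?(ltW e0) //.
rewrite /supnorm; elim/big_ind: _ => [|a b Ha Hb|j _].
- by rewrite lecR.
- by rewrite /Num.max; case: ifP.
- by rewrite normc_modc lecR.
Qed.

Lemma rd_torus rho p l : real_diff_at (fun y => torus rho y l) p
  (fun i => (i == Some l)%:R * ((2 * pi)%:C * 'i * torus rho p l)).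
Proof.
apply: eq_rdc (rdM (rd_cst p rho%:C) (rd_cis p (Some l))) => i.
by rewrite /torus; ring.
Qed.

Lemma torus_neq rho z y l : modc (z l) < rho ->
  torus rho y l != 0 /\ torus rho y l - z l != 0.
Proof.
move=> zr; have r0 : 0 < rho := le_lt_trans (modc_ge0 _) zr.
have T := modc_torus y l (ltW r0).
split; first by rewrite -modc_eq0 T gt_eqF.
rewrite subr_eq0; apply: contraTneq zr => <-; by rewrite T ltxx.
Qed.

Lemma cont_cauchy_factor rho z p l : modc (z l) < rho ->
  cont_at (cauchy_factor rho z l) p.
Proof.
move=> zr; have [T0 Tz] := torus_neq p zr.
have Tc := rd_cont (rd_torus rho p l).
apply: contV.
  by rewrite -(divff T0) -mulrBl mulf_neq0 ?invr_eq0.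
have := contD (cont_cst p 1) (contM (cont_cst p (- z l)) (contV T0 Tc)).
by apply: eq_cont => y; rewrite mulNr.
Qed.

Lemma indep_cauchy_factor rho z l i : i != Some l -> indep i (cauchy_factor rho z l).
Proof. by move=> il y y' yy'; rewrite /cauchy_factor /torus yy' // eq_sym. Qed.

Lemma cont_cauchy_kernel rho z p : (forall l, modc (z l) < rho) ->
  cont_at (cauchy_kernel rho z) p.
Proof. by move=> zr; apply: cont_prod => l _; exact: cont_cauchy_factor. Qed.

(* The tori z + s (T - z), eps <= s <= 1, shrink towards z while the form
   f(z + s (T - z)) prod_l dT_l / (T_l - z_l) stays closed; its exterior derivative
   is the divergence of the field with components [wt]. *)
Lemma cauchy_homotopy f z rho eps :
  holomorphic_on (@polydisc R n) f -> rho < 1 -> (forall l, modc (z l) < rho) ->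
  0 < eps < 1 -> forall e, 0 < e -> exists N0, forall N, (N0 <= N)%N ->
  modc (mean N (fun=> 0) 0 (fun y => cauchy_kernel rho z y *
    (f (torus rho y) - f (fun l => z l + eps%:C * (torus rho y l - z l))))) <= e.
Proof.
move=> fhol r1 zr /andP[eps0 eps1] e e0.
(* The scale runs from [eps] to 1 along the coordinate [None]; [eps > 0] keeps the factor $1/s$ of
   the field continuous. *)
pose s y : R[i] := eps%:C + (1 - eps)%:C * (y None)%:C.
pose Z l y := z l + s y * (torus rho y l - z l).
pose G y := f (Z ^~ y).
(* Leaving out factor [l] makes component [l] independent of coordinate [l]. Its constant balances
   the speeds of [Z l]: $(1-\varepsilon)(T_l-z_l)$ along [None] against $2\pi i\,sT_l$ along
   [Some l]. *)
pose wt i y := if i is Some l then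
  - ((1 - eps)%:C / ((2 * pi)%:C * 'i)) * (s y)^-1 *
    \prod_(k | k != l) cauchy_factor rho z k y
  else cauchy_kernel rho z y.
have sE y : s y = (eps + (1 - eps) * y None)%:C by rewrite /s -rmorphM -rmorphD.
have s_rd p : real_diff_at s p (fun i => (1 - eps)%:C * (i == None)%:R).
  have := rdD (rd_cst p eps%:C) (rdM (rd_cst p (1 - eps)%:C) (rd_coord p None)).
  by apply: eq_rdc => i; ring.
have Z_rd p l : real_diff_at (Z l) p (fun i =>
    (1 - eps)%:C * (i == None)%:R * (torus rho p l - z l) +
    s p * ((i == Some l)%:R * ((2 * pi)%:C * 'i * torus rho p l))).
  have := rdD (rd_cst p (z l)) (rdM (s_rd p) (rdD (rd_torus rho p l) (rd_cst p (- z l)))).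
  by apply: eq_rdc => i; ring.
have pi0 : (2 * pi)%:C * 'i != 0 :> R[i].
  rewrite -modc_eq0 modcM modc_real mulf_neq0 //.
    by rewrite normr_eq0 mulf_neq0 // gt_eqF // pi_gt0.
  by rewrite /modc /= expr0n expr1n add0r sqrtr1 oner_neq0.
have wt_indep i : indep i (wt i).
  case: i => [l|] y y' yy' /=.
    rewrite sE sE yy' //; congr (_ * _); apply: eq_bigr => k kl.
    by apply: (@indep_cauchy_factor _ _ _ (Some l)) yy'; apply: contra kl => /eqP[->].
  by apply: eq_bigr => k _; apply: (@indep_cauchy_factor _ _ _ None) yy'.
have [p pc|N0 HN0] := @flux_limit R I wt G wt_indep _ e e0.
  have /andP[p0 p1] := pc None; rewrite /side expr0 add0r in p1.
  have sp_ge : eps <= eps + (1 - eps) * p None.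
    by rewrite lerDl mulr_ge0 //; lra.
  have sp_le : eps + (1 - eps) * p None <= 1.
    have : (1 - eps) * p None <= (1 - eps) * 1 by apply: ler_wpM2l => //; lra.
    lra.
  have s0 : s p != 0.
    by rewrite sE -modc_eq0 modc_real normr_eq0 gt_eqF //; lra.
  split=> [[l|] /=|].
  - apply: contM; last by apply: cont_prod => k _; exact: cont_cauchy_factor.
    apply: contM; first exact: cont_cst.
    by apply: contV => //; exact: rd_cont (s_rd p).
  - exact: cont_cauchy_kernel.
  (* [Z] is a convex combination of [z] and a point of the torus, so it stays where [f] is
     differentiable. *)
  have Zp : polydisc (Z ^~ p).
    apply/polydiscP => l; rewrite /Z sE; set t := (_ + _ : R) in sp_ge sp_le *.
    rewrite (_ : _ + _ = (1 - t)%:C * z l + t%:C * torus rho p l); last first.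
      by rewrite rmorphB rmorph1; ring.
    have r0 : 0 <= rho := ltW (le_lt_trans (modc_ge0 _) (zr l)).
    apply: le_lt_trans (modcD _ _) _.
    rewrite (modcM _ (z l)) (modcM _ (torus _ _ _)) modc_torus // !modc_real.
    rewrite !ger0_norm; [|lra|lra].
    have : (1 - t) * modc (z l) <= (1 - t) * rho.
      by apply: ler_wpM2l; [lra|exact: ltW].
    lra.
  have [a Ha] := C_differentiable_modc (fhol _ Zp).
  exists (fun i => \sum_l a l * ((1 - eps)%:C * (i == None)%:R * (torus rho p l - z l) +
    s p * ((i == Some l)%:R * ((2 * pi)%:C * 'i * torus rho p l)))).
    exact: rd_comp Ha (Z_rd p).
  (* The divergence vanishes for each [l] separately: the kernel times $T_l-z_l$ is $T_l$ times the
     product of the other factors. *)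
  rewrite big_option /= mulr_sumr -big_split big1 //= => l _.
  rewrite (_ : \sum_m a m * _ = a l * (s p * ((2 * pi)%:C * 'i * torus rho p l))).
    2: { rewrite (bigD1 l) //= big1 ?addr0 => [|m ml]; last first.
      rewrite (_ : (Some l == Some m) = false).
        by rewrite !(mulr0n, mulr0, mul0r, addr0).
      by apply/negbTE; apply: contra ml => /eqP[->].
    by rewrite eqxx !(mulr0n, mulr1n, mulr0, mul0r, mul1r, add0r). }
  rewrite /cauchy_kernel (bigD1 l) //= /cauchy_factor.
  have [T0 Tz] := torus_neq p (zr l).
  move: ((2 * pi)%:C * 'i) pi0 (s p) s0 (torus rho p l) T0 Tz => c2 c20 t t0 T T0 Tz.
  by field; rewrite t0 c20 T0 Tz.
(* By periodicity [G] agrees on opposite faces in the torus directions, so only the two faces in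
   direction [None] contribute. *)
exists N0 => N /HN0; rewrite big_option big1 ?addr0 => [|l _]; last first.
  rewrite -[RHS](@mean_cst R I N (fun=> 0) 0); apply: eq_mean => y _.
  rewrite (_ : G _ = G (upd y (Some l) 0)) ?subrr ?mulr0 //.
  rewrite /G; congr f; apply/funext => m; rewrite /Z /s /torus /upd /=.
  by case: eqP => // _; rewrite cis0 cis1.
congr (modc _ <= _); apply: eq_mean => y _; congr (_ * (f _ - f _)).
  apply/funext => l; rewrite /Z sE /upd /= mulr1.
  rewrite (_ : eps + (1 - eps) = 1); last by ring.
  by rewrite rmorph1 /torus /=; ring.
by apply/funext => l; rewrite /Z sE /upd /= mulr0 addr0.
Qed.

End CauchyHomotopy.

(** * Limits and measurability of complex sequences *)

Section Limits.
Variable R : realType.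
Implicit Types (u v : nat -> R[i]) (a b : R[i]).

Definition tends u a := forall e : R, 0 < e -> exists N0, forall N, (N0 <= N)%N ->
  modc (u N - a) <= e.

Lemma tends_eventually u v a N1 : (forall N, (N1 <= N)%N -> u N = v N) ->
  tends u a -> tends v a.
Proof.
move=> uv ua e /ua[N0 HN0]; exists (maxn N0 N1) => N.
by rewrite geq_max => /andP[/HN0 + /uv <-].
Qed.

Lemma tends_cst a : tends (fun=> a) a.
Proof. by move=> e e0; exists 0%N => N _; rewrite subrr modc0 ltW. Qed.

Lemma tendsD u v a b : tends u a -> tends v b -> tends (fun N => u N + v N) (a + b).
Proof.
move=> ua vb e e0; have e20 : 0 < e / 2 by rewrite divr_gt0.
have [N1 H1] := ua _ e20; have [N2 H2] := vb _ e20.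
exists (maxn N1 N2) => N; rewrite geq_max => /andP[/H1 h1 /H2 h2].
rewrite opprD addrACA; apply: le_trans (modcD _ _) _; lra.
Qed.

Lemma tendsZ c u a : tends u a -> tends (fun N => c * u N) (c * a).
Proof.
move=> ua e e0; have c0 := modc_ge0 c.
have c1 : 0 < modc c + 1 by lra.
have [N0 H0] := ua _ (divr_gt0 e0 c1); exists N0 => N /H0.
rewrite ler_pdivlMr // mulrDr mulr1 -mulrBr modcM.
by have := modc_ge0 (u N - a); lra.
Qed.

Lemma tends_sum (J : Type) (r : seq J) (U : J -> nat -> R[i]) (A : J -> R[i]) :
  (forall j, tends (U j) (A j)) ->
  tends (fun N => \sum_(j <- r) U j N) (\sum_(j <- r) A j).
Proof.
move=> UA; elim: r => [|j r IH].
  rewrite big_nil; apply: (@tends_eventually (fun=> 0) _ _ 0); last exact: tends_cst.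
  by move=> N _; rewrite big_nil.
rewrite big_cons; apply: (@tends_eventually _ _ _ 0) (tendsD (UA j) IH) => N _.
by rewrite big_cons.
Qed.

Lemma tends_le u a B : tends u a -> (exists N0, forall N, (N0 <= N)%N -> modc (u N) <= B) ->
  modc a <= B.
Proof.
move=> ua [N1 uB]; apply/ler_addgt0Pr => e /ua[N0 H0].
have H1 := H0 (maxn N0 N1) (leq_maxl _ _); have H2 := uB (maxn N0 N1) (leq_maxr _ _).
have := modcB (u (maxn N0 N1)) (u (maxn N0 N1) - a).
by rewrite opprB addrC subrK; lra.
Qed.

Import numFieldNormedType.Exports.

Lemma cauchy_real_cvg (u : nat -> R) :
  (forall e, 0 < e -> exists N0, forall N, (N0 <= N)%N -> forall d,
     `|u (N + d)%N - u N| <= e) -> cvgn u.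
Proof.
move=> uc; apply/cauchy_cvgP/cauchy_ballP => e e0.
have [N0 H0] := uc (e / 3) (divr_gt0 e0 (ltr0Sn _ _)).
pose U := [set u k | k in [set k | (N0 <= k)%N]]%classic.
exists (U, U); first by split; exists N0 => // k kN; exists k.
move=> _ [[a Na <-] [b Nb <-]]; rewrite /ball /=.
have := H0 N0 (leqnn _) (a - N0)%N; have := H0 N0 (leqnn _) (b - N0)%N.
rewrite !subnKC // => h1 h2.
rewrite (_ : _ - _ = (u a - u N0) - (u b - u N0)); last by ring.
apply: le_lt_trans (ler_normB _ _) _; lra.
Qed.

Lemma cauchy_tends u :
  (forall e, 0 < e -> exists N0, forall N, (N0 <= N)%N -> forall d,
     modc (u (N + d)%N - u N) <= e) -> exists a, tends u a.
Proof.
move=> uc.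
have cre : cvgn (fun N => complex.Re (u N)).
  apply: cauchy_real_cvg => e /uc[N0 H0]; exists N0 => N /H0 H d.
  by apply: le_trans (H d); rewrite -raddfB modc_Re.
have cim : cvgn (fun N => complex.Im (u N)).
  apply: cauchy_real_cvg => e /uc[N0 H0]; exists N0 => N /H0 H d.
  by apply: le_trans (H d); rewrite -raddfB modc_Im.
exists (limn (fun N => complex.Re (u N)) +i* limn (fun N => complex.Im (u N))) => e e0.
have e20 : 0 < e / 2 by rewrite divr_gt0.
move/cvgrPdist_le : cre => /(_ _ e20)[N1 _ H1].
move/cvgrPdist_le : cim => /(_ _ e20)[N2 _ H2].
exists (maxn N1 N2) => N; rewrite geq_max => /andP[/H1 /= h1 /H2 /= h2].
apply: le_trans (modc_ReIm _) _; rewrite !raddfB /=.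
by rewrite distrC in h1; rewrite distrC in h2; lra.
Qed.

Lemma tends_cvg u a : tends u a ->
  ((fun N => complex.Re (u N)) @ \oo --> complex.Re a)%classic /\
  ((fun N => complex.Im (u N)) @ \oo --> complex.Im a)%classic.
Proof.
move=> ua; split; apply/cvgrPdist_le => e /ua[N0 H0]; exists N0 => // N /H0;
  rewrite distrC; apply: le_trans; rewrite -raddfB; [exact: modc_Re|exact: modc_Im].
Qed.

Lemma measurable_C_tends d (T : measurableType d) (u : nat -> T -> R[i]) (a : T -> R[i]) :
  (forall N, measurable_C (u N)) -> (forall w, tends (u^~ w) (a w)) -> measurable_C a.
Proof.
move=> um ua; split.
  apply: (measurable_fun_cvg (h := fun N w => complex.Re (u N w)) (fun N => (um N).1)) => w _.
  exact: (tends_cvg (ua w)).1.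
apply: (measurable_fun_cvg (h := fun N w => complex.Im (u N w)) (fun N => (um N).2)) => w _.
exact: (tends_cvg (ua w)).2.
Qed.

Lemma measurable_C_cst d (T : measurableType d) (c : R[i]) :
  measurable_C (fun _ : T => c).
Proof. by split; exact: measurable_cst. Qed.

Lemma measurable_CD d (T : measurableType d) (g h : T -> R[i]) :
  measurable_C g -> measurable_C h -> measurable_C (fun w => g w + h w).
Proof.
move=> [g1 g2] [h1 h2]; split; under eq_fun do rewrite raddfD /=.
  exact: measurable_funD.
exact: measurable_funD.
Qed.

Lemma measurable_CZ d (T : measurableType d) (c : R[i]) (g : T -> R[i]) :
  measurable_C g -> measurable_C (fun w => c * g w).
Proof.
move=> [g1 g2]; split.
  rewrite (_ : (fun w => _) = fun w =>
    complex.Re c * complex.Re (g w) - complex.Im c * complex.Im (g w)).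
    by apply: measurable_funB; apply: measurable_funM.
  by apply/funext => w; case: c (g w) => ? ? [? ?].
rewrite (_ : (fun w => _) = fun w =>
  complex.Re c * complex.Im (g w) + complex.Im c * complex.Re (g w)).
  by apply: measurable_funD; apply: measurable_funM.
by apply/funext => w; case: c (g w) => ? ? [? ?].
Qed.

Lemma measurable_C_mean d (T : measurableType d) (I : finType)
    (g : T -> (I -> R) -> R[i]) N x k : (forall y, measurable_C (g ^~ y)) ->
  measurable_C (fun w => mean N x k (g w)).
Proof.
move=> gm; elim: N x k => [|N IH] x k /=; first exact: gm.
rewrite /avg; under [X in measurable_C X]eq_fun do rewrite mulrC.
apply: measurable_CZ; elim: (index_enum _) => [|s r IHr].
  by under eq_fun do rewrite big_nil; exact: measurable_C_cst.
by under eq_fun do rewrite big_cons; exact: measurable_CD.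
Qed.

End Limits.

(** * Geometric estimates *)

Section MultiBoxes.
Variable n : nat.

(** Truncation is coordinatewise and not by total degree, so that sums of products over the box
    factor into one-variable sums. *)
Definition multi_box (m : nat) : seq (n.-tuple nat) :=
  [seq [tuple nat_of_ord (b l) | l < n] | b : {ffun 'I_n -> 'I_m}].

Lemma mem_multi_box m (t : n.-tuple nat) :
  (t \in multi_box m) = [forall l, (tnth t l < m)%N].
Proof.
apply/mapP/forallP => [[b _ ->] l|tm]; first by rewrite tnth_mktuple.
exists [ffun l => Ordinal (tm l)]; first by rewrite mem_enum.
by apply: eq_from_tnth => l; rewrite tnth_mktuple ffunE.
Qed.

Lemma uniq_multi_box m : uniq (multi_box m).
Proof.
rewrite map_inj_uniq ?enum_uniq // => b b' bb'; apply/ffunP => l; apply/val_inj.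
by have := congr1 (fun t : n.-tuple nat => tnth t l) bb'; rewrite !tnth_mktuple.
Qed.

Lemma sub_multi_box (s : seq (n.-tuple nat)) : exists M, {subset s <= multi_box M}.
Proof.
exists (\max_(t <- s) \max_l tnth t l).+1 => t ts; rewrite mem_multi_box.
apply/forallP => l; rewrite ltnS; apply: leq_trans (leq_bigmax l) _.
exact: (@leq_bigmax_seq _ s xpredT (fun t : n.-tuple nat => \max_l tnth t l)).
Qed.

Lemma sum_multi_box (A : comNzRingType) m (F : 'I_n -> nat -> A) :
  \sum_(t <- multi_box m) \prod_l F l (tnth t l) = \prod_l \sum_(k < m) F l k.
Proof.
rewrite bigA_distr_bigA big_map big_enum /=.
by apply: eq_bigr => b _; apply: eq_bigr => l _; rewrite tnth_mktuple.
Qed.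

Lemma sum_subset (A : nmodType) (s t : seq (n.-tuple nat)) (F : n.-tuple nat -> A) :
  uniq s -> uniq t -> {subset s <= t} ->
  \sum_(a <- t) F a = \sum_(a <- s) F a + \sum_(a <- t | a \notin s) F a.
Proof.
move=> us ut st; rewrite (bigID (mem s)) /=; congr (_ + _).
rewrite -big_filter; apply: perm_big; apply: uniq_perm => //; first exact: filter_uniq.
by move=> a; rewrite mem_filter; case: (boolP (a \in s)) => //= /st.
Qed.

End MultiBoxes.

Section GeometricBounds.
Variable R : realType.

Lemma prod1D_sub1 (n : nat) (a : 'I_n -> R[i]) (x : R) : 0 <= x <= 1 ->
  (forall l, modc (a l) <= x) -> modc (\prod_l (1 + a l) - 1) <= 2 ^+ n * x.
Proof.
move=> /andP[x0 x1] ax.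
(* The extra [- x] closes the induction: $(2^n x-x)+2^n x=2^{n+1}x-x$. *)
suff: modc (\prod_l (1 + a l) - 1) <= 2 ^+ n * x - x by lra.
elim: n a ax => [|n IH] a ax; first by rewrite big_ord0 subrr modc0; lra.
rewrite big_ord_recl exprS; set P := \prod_(i < n) _.
have IHP : modc (P - 1) <= 2 ^+ n * x - x by apply: IH => l; exact: ax.
have P2 : modc P <= 2 ^+ n.
  rewrite modc_prod; apply: le_trans (_ : \prod_(i < n) (2 : R) <= _).
    apply: ler_prod => l _; rewrite modc_ge0 /=.
    by apply: le_trans (modcD _ _) _; rewrite modc1; have := ax (lift ord0 l); lra.
  by rewrite prodr_const card_ord.
rewrite (_ : _ - 1 = (P - 1) + a ord0 * P); last by ring.
apply: le_trans (modcD _ _) _; rewrite modcM.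
have : modc (a ord0) * modc P <= x * 2 ^+ n by apply: ler_pM; rewrite ?modc_ge0.
lra.
Qed.

(** $(1-q)^{-n}$ bounds the full geometric product; $2^n$ comes from the relative error of
    truncating it. *)
Definition geom_const (n : nat) (q : R) : R := (1 - q)^-1 ^+ n * 2 ^+ n.

(** A truncated geometric sum is $(1-u^m)/(1-u)$, so the truncated product is the full one times
    $\prod_l(1-u_l^m)$, which is within $2^nq^m$ of 1. *)
Lemma geom_truncation (n : nat) (u : 'I_n -> R[i]) (q : R) m : 0 <= q < 1 ->
  (forall l, modc (u l) <= q) ->
  modc (\prod_l (1 - u l)^-1) <= (1 - q)^-1 ^+ n /\
  modc (\prod_l (1 - u l)^-1 - \prod_l \sum_(k < m) u l ^+ k) <=
    geom_const n q * q ^+ m.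
Proof.
move=> /andP[q0 q1] uq.
have u1 l : 1 - q <= modc (1 - u l).
  have := modcD (1 - u l) (u l); rewrite subrK modc1; have := uq l; lra.
have v0 l : 1 - u l != 0 by rewrite -modc_eq0 gt_eqF //; have := u1 l; lra.
have bound : modc (\prod_l (1 - u l)^-1) <= (1 - q)^-1 ^+ n.
  rewrite modc_prod; apply: le_trans (_ : \prod_(i < n) (1 - q)^-1 <= _).
    apply: ler_prod => l _; rewrite modc_ge0 modcV /= lef_pV2 ?posrE ?u1 //;
      by have := u1 l; lra.
  by rewrite prodr_const card_ord.
split=> //.
have -> : \prod_l \sum_(k < m) u l ^+ k =
    \prod_l (1 - u l)^-1 * \prod_l (1 + - u l ^+ m).
  rewrite -big_split; apply: eq_bigr => l _ /=.
  apply: (mulfI (v0 l)); rewrite mulrA divff // mul1r -opprB mulNr -subrX1.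
  by rewrite opprB.
rewrite -[X in modc (X - _)]mulr1 -mulrBr modcM modc_distC /geom_const -mulrA.
apply: ler_pM; rewrite ?modc_ge0 //.
apply: prod1D_sub1; first by rewrite exprn_ge0 // exprn_ile1 // ltW.
by move=> l; rewrite modcN modcX lerXn2r ?nnegrE ?modc_ge0.
Qed.

Lemma small_geometric (q C e : R) : 0 <= q < 1 -> 0 < e ->
  exists m0, forall m, (m0 <= m)%N -> C * q ^+ m <= e.
Proof.
move=> /andP[q0 q1] e0.
have C0 : 0 < `|C| + 1 by rewrite ltr_wpDl.
have : `|q| < 1 by rewrite ger0_norm.
move=> /cvg_expr /cvgrPdist_le /(_ _ (divr_gt0 e0 C0))[m0 _ H]; exists m0 => m /H /=.
rewrite sub0r normrN normrX (ger0_norm q0) ler_pdivlMr //.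
have := ler_norm C; have := exprn_ge0 m q0; move: (q ^+ m) => x x0 Cx.
by have := ler_wpM2r x0 Cx; lra.
Qed.

(** Enlarging [s] to a box of size [M] gives the closed form $(1-q)^{-n}(1-q^M)^n$; the part outside
    the small box is then at most $(1-q)^{-n}(1-(1-q^m)^n)$. *)
Lemma geom_sum_le (n : nat) (s : seq (n.-tuple nat)) (q : R) m : 0 <= q < 1 ->
  uniq s -> {subset multi_box n m <= s} ->
  \sum_(a <- s | a \notin multi_box n m) \prod_l q ^+ tnth a l <= geom_const n q * q ^+ m.
Proof.
move=> q01 us ms; have /andP[q0 q1] := q01.
have term_ge0 (a : n.-tuple nat) : 0 <= \prod_l q ^+ tnth a l.
  by apply: prodr_ge0 => l _; rewrite exprn_ge0.
have boxE M : \sum_(a <- multi_box n M) \prod_l q ^+ tnth a l =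
    (1 - q)^-1 ^+ n * (1 - q ^+ M) ^+ n.
  rewrite (sum_multi_box M (fun _ k => q ^+ k)) prodr_const card_ord -exprMn.
  congr (_ ^+ n); apply: (@mulfI _ (1 - q)); first by rewrite subr_eq0 gt_eqF.
  rewrite mulrA divff ?mul1r; last by rewrite subr_eq0 gt_eqF.
  by rewrite -opprB mulNr -subrX1 opprB.
have [M sM] := sub_multi_box s.
have H1 := sum_subset (fun a => \prod_l q ^+ tnth a l) (uniq_multi_box n m) us ms.
have H2 := sum_subset (fun a => \prod_l q ^+ tnth a l) us (uniq_multi_box n M) sM.
have H3 : 0 <= \sum_(a <- multi_box n M | a \notin s) \prod_l q ^+ tnth a l.
  by apply: sumr_ge0 => a _.
have qX k : 0 <= q ^+ k <= 1 by rewrite exprn_ge0 // exprn_ile1 // ltW.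
have H4 : (1 - q ^+ M) ^+ n <= 1.
  by apply: exprn_ile1; have := qX M; lra.
have H5 : 1 - (1 - q ^+ m) ^+ n <= 2 ^+ n * q ^+ m.
  have qm (l : 'I_n) : modc (- q ^+ m)%:C <= q ^+ m.
    by rewrite modc_real normrN ger0_norm ?exprn_ge0.
  have := prod1D_sub1 (qX m) qm.
  rewrite prodr_const card_ord -(rmorph1 (real_complex R)) -rmorphD -rmorphXn.
  by rewrite -rmorphB modc_real distrC => /(le_trans (ler_norm _)).
rewrite !boxE in H1 H2.
have K0 : 0 <= (1 - q)^-1 ^+ n by rewrite exprn_ge0 // invr_ge0; lra.
rewrite /geom_const -mulrA.
have := ler_wpM2l K0 H5; have := ler_wpM2l K0 H4.
set K := (1 - q)^-1 ^+ n in H1 H2 K0 *; rewrite !mulr1 => h4 h5.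
lra.
Qed.

End GeometricBounds.

(** * Power series expansion *)

Section PowerSeries.
Variables (R : realType) (n : nat).
Local Notation I := (option 'I_n).
Implicit Types (y p : I -> R) (z : 'I_n -> R[i]) (f : ('I_n -> R[i]) -> R[i]).
Implicit Types (a b : n.-tuple nat).

(* Riemann sums for the Cauchy integral giving the Taylor coefficients of f. *)
Definition coef f (rho : R) a N : R[i] :=
  mean N (fun=> 0) 0 (fun y : I -> R =>
    f (torus rho y) * \prod_l (torus rho y l)^-1 ^+ tnth a l).

Lemma kernel_truncation z rho q m y : 0 < rho -> 0 <= q < 1 ->
  (forall l, modc (z l) <= q * rho) ->
  modc (cauchy_kernel rho z y) <= (1 - q)^-1 ^+ n /\
  modc (cauchy_kernel rho z y - \sum_(a <- multi_box n m)
    monomial a z * \prod_l (torus rho y l)^-1 ^+ tnth a l) <= geom_const n q * q ^+ m.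
Proof.
move=> r0 q01 zq.
have uq l : modc (z l / torus rho y l) <= q.
  by rewrite modcM modcV modc_torus ?(ltW r0) // ler_pdivrMr.
have [? H] := geom_truncation m q01 uq; split=> //.
apply: le_trans H; rewrite -(sum_multi_box m (fun l k => (z l / torus rho y l) ^+ k)).
under [X in _ <= modc (_ - X)]eq_bigr do under eq_bigr do rewrite exprMn.
by under [X in _ <= modc (_ - X)]eq_bigr do rewrite big_split.
Qed.

(** The bound is the same at every depth [N], hence survives the passage to the limit. *)
Lemma mean_kernel_truncation f z rho q m B N : 0 < rho -> 0 <= q < 1 ->
  (forall l, modc (z l) <= q * rho) ->
  (forall y, unit_cube y -> modc (f (torus rho y)) <= B) ->
  modc (mean N (fun=> 0) 0 (fun y : I -> R => cauchy_kernel rho z y * f (torus rho y))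
    - \sum_(a <- multi_box n m) coef f rho a N * monomial a z)
  <= B * (geom_const n q * q ^+ m).
Proof.
move=> r0 q01 zq fB.
rewrite (eq_bigr (fun a => mean N (fun=> 0) 0 (fun y : I -> R => monomial a z *
    (f (torus rho y) * \prod_l (torus rho y l)^-1 ^+ tnth a l)))); last first.
  by move=> a _; rewrite meanZ mulrC.
rewrite -mean_sum -meanB; apply: mean_le => y yc.
rewrite (_ : _ - _ = f (torus rho y) * (cauchy_kernel rho z y - \sum_(a <- multi_box n m)
    monomial a z * \prod_l (torus rho y l)^-1 ^+ tnth a l)); last first.
  rewrite mulrBr mulr_sumr [X in X - _]mulrC; congr (_ - _).
  by apply: eq_bigr => a _; rewrite mulrCA.
rewrite modcM; apply: ler_pM; rewrite ?modc_ge0 //; first exact: fB.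
exact: (kernel_truncation m y r0 q01 zq).2.
Qed.

Lemma tends_coef_monomial rho b a : 0 < rho ->
  tends (coef (monomial b) rho a) (b == a)%:R.
Proof.
move=> r0; have [N0 HN0] := @mean_monomial R n (tnth b) (tnth a).
have rC : rho%:C != 0 :> R[i] by rewrite -modc_eq0 modc_real normr_eq0 gt_eqF.
move=> e e0; exists N0 => N /HN0 HN; rewrite /coef.
pose c : R[i] := \prod_l (rho%:C ^+ tnth b l * rho%:C^-1 ^+ tnth a l).
rewrite (@eq_mean _ _ N _ _ _ (fun y : I -> R => c * \prod_l (cis (y (Some l)) ^+ tnth b l *
    (cis (y (Some l)))^-1 ^+ tnth a l))); last first.
  move=> y _; rewrite /c /monomial -!big_split; apply: eq_bigr => l _ /=.
  by rewrite /torus invfM !exprMn; ring.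
rewrite meanZ HN (_ : [forall l, _] = (b == a)); last first.
  apply/forallP/eqP => [ba|-> //]; apply: eq_from_tnth => l; exact/eqP.
case: eqP => [ba|_]; last by rewrite mulr0 subrr modc0 ltW.
rewrite /c -ba big1 ?mul1r ?subrr ?modc0 ?ltW // => l _.
by rewrite exprVn divff // expf_neq0.
Qed.

(** Cauchy's formula for the constant 1: after truncation, orthogonality leaves only the multi-index
    0. *)
Lemma tends_mean_kernel z rho q : 0 < rho -> 0 <= q < 1 ->
  (forall l, modc (z l) <= q * rho) ->
  tends (fun N => mean N (fun=> 0) 0 (cauchy_kernel rho z)) 1.
Proof.
move=> r0 q01 zq e e0; have e20 : 0 < e / 2 by rewrite divr_gt0.
(* The successor guarantees that the box contains the multi-index 0. *)
have [m0 /(_ m0.+1 (leqnSn _)) Hm] := small_geometric (geom_const n q) q01 e20.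
set m := m0.+1 in Hm.
pose t0 : n.-tuple nat := [tuple 0%N | l < n].
have mono0 : monomial t0 = fun=> 1 :> R[i].
  by apply/funext => x; apply: big1 => l _; rewrite tnth_mktuple expr0.
have t0m : t0 \in multi_box n m.
  by rewrite mem_multi_box; apply/forallP => l; rewrite tnth_mktuple.
have := @tends_sum R _ (multi_box n m) (fun a N => coef (fun=> 1) rho a N * monomial a z)
  (fun a => (t0 == a)%:R * monomial a z) _ _ e20.
case=> [a|N0 HN0].
  rewrite mulrC.
  apply: (@tends_eventually R (fun N => monomial a z * coef (fun=> 1) rho a N) _ _ 0).
    by move=> N _; rewrite mulrC.
  by apply: tendsZ; rewrite -mono0; exact: tends_coef_monomial.
exists N0 => N /HN0.
rewrite [X in _ - X](_ : _ = 1); last first.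
  rewrite (bigD1_seq t0) ?uniq_multi_box //= eqxx mul1r mono0 big1 ?addr0 // => a.
  by rewrite eq_sym => /negPf ->; rewrite mul0r.
have := @mean_kernel_truncation (fun=> 1) z rho q m 1 N r0 q01 zq _.
rewrite modc1 lexx mul1r => /(_ (fun _ _ => isT)).
under eq_mean do rewrite mulr1.
set u := mean _ _ _ _; set S := \sum_(_ <- _) _ => H1 H2.
rewrite (_ : u - 1 = (u - S) + (S - 1)); last by ring.
apply: le_trans (modcD _ _) _; lra.
Qed.

Lemma C_differentiable_cont f z : C_differentiable_at f z ->
  forall e, 0 < e -> exists2 d : R, 0 < d & forall h, (forall j, modc (h j) <= d) ->
    modc (f (fun j => z j + h j) - f z) <= e.
Proof.
move=> /C_differentiable_modc[c Hc] e e0; have [d d0 Hd] := Hc 1 ltr01.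
have S0 : 0 <= \sum_j modc (c j) by apply: sumr_ge0 => j _; exact: modc_ge0.
have S1 : 0 < \sum_j modc (c j) + 1 by lra.
pose eta := Num.min d (e / (\sum_j modc (c j) + 1)).
have eta0 : 0 < eta by rewrite lt_min d0 divr_gt0.
exists eta => // h hh; have := Hd eta h; rewrite (ltW eta0) ge_min lexx mul1r.
move=> /(_ isT hh); set S := \sum_j c j * h j => H1.
have H2 : modc S <= (\sum_j modc (c j)) * eta.
  apply: le_trans (modc_sum _ _ _) _; rewrite mulr_suml; apply: ler_sum => j _.
  by rewrite modcM ler_wpM2l ?modc_ge0.
have H3 : eta * (\sum_j modc (c j) + 1) <= e.
  by rewrite -ler_pdivlMr // ge_min lexx orbT.
rewrite -[_ - _](subrK S); apply: le_trans (modcD _ _) _; lra.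
Qed.

Section Holomorphic.
Variable f : ('I_n -> R[i]) -> R[i].
Hypothesis f_hol : holomorphic_on (@polydisc R n) f.

Lemma torus_polydisc rho y : 0 < rho < 1 -> polydisc (torus rho y).
Proof.
by move=> /andP[r0 r1]; apply/polydiscP => l; rewrite modc_torus // ltW.
Qed.

Theorem cauchy_formula z rho q : 0 < rho < 1 -> 0 <= q < 1 ->
  (forall l, modc (z l) <= q * rho) ->
  tends (fun N => mean N (fun=> 0) 0
    (fun y : I -> R => cauchy_kernel rho z y * f (torus rho y))) (f z).
Proof.
move=> /andP[r0 r1] q01 zq e e0; have /andP[q0 q1] := q01.
have zr l : modc (z l) < rho.
  by apply: le_lt_trans (zq l) _; rewrite gtr_pMl.
have zP : polydisc z by apply/polydiscP => l; exact: lt_trans (zr l) r1.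
pose K := (1 - q)^-1 ^+ n.
have K0 : 0 <= K by rewrite exprn_ge0 // invr_ge0; lra.
have K1 : 0 < K + 1 by lra.
have e30 : 0 < e / 3 by rewrite divr_gt0.
have [d d0 Hd] := C_differentiable_cont (f_hol zP) (divr_gt0 e30 K1).
(* Since $|T_l-z_l|\le 2$, the bound [d / 2] puts the last torus within [d] of [z]; [2^-1] ensures
   [eps < 1]. *)
pose eps := Num.min (d / 2) 2^-1.
have eps0 : 0 < eps by rewrite lt_min divr_gt0 //= invr_gt0.
have eps_d : eps <= d / 2 by rewrite ge_min lexx.
have eps_2 : eps <= 2^-1 by rewrite ge_min lexx orbT.
have [|N1 H1] := cauchy_homotopy f_hol r1 zr (eps := eps) _ e30.
  by rewrite eps0 /=; lra.
have [N2 H2] := tendsZ (f z) (tends_mean_kernel r0 q01 zq) e30.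
exists (maxn N1 N2) => N; rewrite geq_max => /andP[/H1 h1 /H2 h2].
pose fe y := f (fun l => z l + eps%:C * (torus rho y l - z l)).
have h3 : modc (mean N (fun=> 0) 0 (fun y => cauchy_kernel rho z y * (fe y - f z))) <= e / 3.
  apply: mean_le => y _; rewrite modcM.
  have hd : modc (fe y - f z) <= e / 3 / (K + 1).
    apply: Hd => j; rewrite modcM modc_real gtr0_norm //.
    have : modc (torus rho y j - z j) <= 2.
      by apply: le_trans (modcB _ _) _; rewrite modc_torus ?(ltW r0) //; have := zr j; lra.
    by move=> /(ler_wpM2l (ltW eps0)); lra.
  have hk := (kernel_truncation 0 y r0 q01 zq).1.
  apply: le_trans (ler_pM (modc_ge0 _) (modc_ge0 _) hk hd) _.
  rewrite -/K mulrCA ler_piMr // ?(ltW e30) //.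
  by rewrite ler_pdivrMr // mul1r; lra.
set u := mean N _ _ (fun y => _ * (f _ - _)) in h1.
set v := mean N _ _ _ in h3.
(* Three errors: along the homotopy, in replacing [f] by [f z] on the last torus, and in Cauchy's
   formula for the constant [f z]. *)
rewrite (_ : _ - _ = u + v + (f z * mean N (fun=> 0) 0 (cauchy_kernel rho z) - f z * 1)).
  apply: le_trans (modcD _ _) _; apply: le_trans (lerD (modcD _ _) (lexx _)) _; lra.
rewrite /u /v -meanZ -meanD mulr1 addrA -meanD; congr (_ - _).
by apply: eq_mean => y _; rewrite /fe; ring.
Qed.

Lemma cont_torus rho p : 0 < rho < 1 -> cont_at (fun y => f (torus rho y)) p.
Proof.
move=> r01; have [c Hc] := C_differentiable_modc (f_hol (torus_polydisc p r01)).
apply: (@rd_cont _ _ _ (fun y => f (torus rho y))).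
exact: (rd_comp (Z := fun l y => torus rho y l) Hc (rd_torus rho p)).
Qed.

Lemma tends_coef rho a : 0 < rho < 1 -> exists A, tends (coef f rho a) A.
Proof.
move=> r01; have /andP[r0 _] := r01.
apply: cauchy_tends; apply: mean_cauchy => p _; apply: contM; first exact: cont_torus.
apply: cont_prod => l _; apply: contX; apply: contV.
  by rewrite -modc_eq0 modc_torus ?(ltW r0) // gt_eqF.
exact: rd_cont (rd_torus rho p l).
Qed.

Lemma torus_bounded rho : 0 < rho < 1 -> exists2 B, 0 <= B &
  forall y : I -> R, unit_cube y -> modc (f (torus rho y)) <= B.
Proof. by move=> r01; apply: cube_bounded => p _; exact: cont_torus. Qed.

(** * Taylor coefficients at one radius *)

Section Coefficients.
Variables (rho B : R) (A : n.-tuple nat -> R[i]).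
Hypothesis rho01 : 0 < rho < 1.
Hypothesis fB : forall y : I -> R, unit_cube y -> modc (f (torus rho y)) <= B.
Hypothesis fA : forall a, tends (coef f rho a) (A a).

Lemma partial_sum_approx z q m : 0 <= q < 1 -> (forall l, modc (z l) <= q * rho) ->
  modc (f z - \sum_(a <- multi_box n m) A a * monomial a z) <=
    B * (geom_const n q * q ^+ m).
Proof.
move=> q01 zq; have /andP[r0 _] := rho01.
have := tendsD (cauchy_formula rho01 q01 zq) (tendsZ (-1)
  (tends_sum (multi_box n m) (fun a => tendsZ (monomial a z) (fA a)))).
rewrite mulN1r; under eq_bigr do rewrite mulrC.
move=> /tends_le; apply; exists 0%N => N _; rewrite mulN1r.
under eq_bigr do rewrite mulrC.
exact: mean_kernel_truncation.
Qed.

(** Cauchy's estimate, valid for each Riemann sum and so for the limit. *)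
Lemma coef_bound a : modc (A a) <= B * \prod_l rho^-1 ^+ tnth a l.
Proof.
have /andP[r0 _] := rho01.
apply: tends_le (fA a) _; exists 0%N => N _; apply: mean_le => y yc.
rewrite modcM modc_prod (eq_bigr (fun l => rho^-1 ^+ tnth a l)) => [|l _].
  by rewrite ler_wpM2r ?fB // prodr_ge0 // => l _; rewrite exprn_ge0 // invr_ge0 ltW.
by rewrite modcX modcV modc_torus // ltW.
Qed.

(* Integrating the expansion on the larger polydisc termwise over the smaller
   torus recovers its coefficients. *)
Lemma coef_radius_indep r A' a : 0 < r < rho -> tends (coef f r a) A' -> A' = A a.
Proof.
move=> /andP[r0 rr] fA'; have /andP[rho0 rho1] := rho01.
pose q := r / rho.
have q01 : 0 <= q < 1 by rewrite divr_ge0 ?(ltW r0) ?(ltW rho0) //= ltr_pdivrMr // mul1r.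
pose D := \prod_l r^-1 ^+ tnth a l.
have D0 : 0 <= D by rewrite prodr_ge0 // => l _; rewrite exprn_ge0 // invr_ge0 ltW.
have key m : a \in multi_box n m ->
    modc (A' - A a) <= B * geom_const n q * D * q ^+ m.
  (* By orthogonality [A a] is the radius [r] coefficient of the partial sum, so [A' - A a] is a
     limit of means of the remainder, which [partial_sum_approx] bounds on the torus with ratio
     [r / rho]. *)
  move=> am; have := tendsD fA' (tendsZ (-1) (tends_sum (multi_box n m)
    (fun b => tendsZ (A b) (tends_coef_monomial b a r0)))).
  rewrite (bigD1_seq a) ?uniq_multi_box //= eqxx mulr1 big1 ?addr0 => [|b /negPf ->]; last first.
    by rewrite mulr0.
  rewrite mulN1r => /tends_le; apply; exists 0%N => N _.
  rewrite mulN1r /coef; under eq_bigr do rewrite -meanZ.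
  rewrite -mean_sum -meanB; apply: mean_le => y _.
  rewrite (_ : _ - _ = (f (torus r y) - \sum_(b <- multi_box n m) A b * monomial b (torus r y))
      * \prod_l (torus r y l)^-1 ^+ tnth a l); last first.
    rewrite mulrBl mulr_suml; congr (_ - _); apply: eq_bigr => b _; exact: mulrA.
  rewrite modcM modc_prod (eq_bigr (fun l => r^-1 ^+ tnth a l)) => [|l _]; last first.
    by rewrite modcX modcV modc_torus // ltW.
  rewrite (_ : B * _ * D * _ = B * (geom_const n q * q ^+ m) * D); last by ring.
  apply: ler_wpM2r => //; apply: partial_sum_approx => // l.
  by rewrite modc_torus ?(ltW r0) // /q divfK ?gt_eqF.
apply/eqP; rewrite -subr_eq0 -modc_eq0; apply/eqP/le_anti; rewrite modc_ge0 andbT.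
apply/ler_addgt0Pr => e e0; rewrite add0r.
have [m0 Hm] := small_geometric (B * geom_const n q * D) q01 e0.
have [m1 Hm1] := sub_multi_box [:: a].
apply: le_trans (key (maxn m0 m1) _) (Hm _ (leq_maxl _ _)).
have := Hm1 a; rewrite inE eqxx !mem_multi_box => /(_ isT) /forallP am.
by apply/forallP => l; apply: leq_trans (am l) (leq_maxr _ _).
Qed.

Lemma power_series_has_sum z : 0 <= B -> (forall l, modc (z l) < rho) ->
  has_sum (fun a => A a * monomial a z) (f z).
Proof.
move=> B0 zr; have /andP[r0 _] := rho01.
pose M := \big[Num.max/0]_l modc (z l).
have M0 : 0 <= M by exact: bigmax_ge_id.
have Mr : M < rho by apply: bigmax_lt => // l _.
pose q := M / rho.
have q01 : 0 <= q < 1 by rewrite divr_ge0 ?(ltW r0) //= ltr_pdivrMr // mul1r.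
have qr : q * rho = M by rewrite /q divfK // gt_eqF.
have zq l : modc (z l) <= q * rho by rewrite qr; exact: le_bigmax_cond.
move=> eps eps0; have eps30 : 0 < eps / 3 by rewrite divr_gt0.
(* One [m] serves twice: the error of the box sum and the tail outside the box have the same
   bound. *)
have [m /(_ m (leqnn m)) Hm] := small_geometric (B * geom_const n q) q01 eps30.
exists (multi_box n m) => s us ms; rewrite normc_modc ltcR.
rewrite (sum_subset _ (uniq_multi_box n m) us ms).
have term a : modc (A a * monomial a z) <= B * \prod_l q ^+ tnth a l.
  rewrite modcM /monomial modc_prod.
  have P0 : 0 <= \prod_l modc (z l ^+ tnth a l).
    by apply: prodr_ge0 => l _; exact: modc_ge0.
  apply: le_trans (ler_wpM2r P0 (coef_bound a)) _; rewrite -mulrA -big_split /=.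
  apply: ler_wpM2l => //; apply: ler_prod => l _.
  rewrite modcX -exprMn exprn_ge0 ?mulr_ge0 ?invr_ge0 ?modc_ge0 ?(ltW r0) //=.
  have h : rho^-1 * modc (z l) <= q by rewrite mulrC ler_pdivrMr.
  by rewrite lerXn2r ?nnegrE ?mulr_ge0 ?invr_ge0 ?modc_ge0 ?(ltW r0) //; case/andP: q01.
have tail : modc (\sum_(a <- s | a \notin multi_box n m) A a * monomial a z) <= eps / 3.
  apply: le_trans (modc_sum _ _ _) _.
  apply: le_trans (ler_sum _ (fun a _ => term a)) _; rewrite -mulr_sumr.
  apply: le_trans (ler_wpM2l B0 (geom_sum_le q01 us ms)) _.
  by rewrite mulrA.
have := partial_sum_approx m q01 zq; rewrite modc_distC mulrA => head.
rewrite addrAC; apply: le_lt_trans (modcD _ _) _; lra.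
Qed.

End Coefficients.
End Holomorphic.
End PowerSeries.

Unset Implicit Arguments.
Local Close Scope complex_scope.

Theorem theorem4p2 (d : measure_display) (Omega : measurableType d)
  (R : realType) (n : nat) (f : Omega -> ('I_n -> R[i]) -> R[i]) :
  random_holomorphic (@polydisc R n) f ->
  exists a : n.-tuple nat -> Omega -> R[i],
    (forall alpha, measurable_C (a alpha)) /\
    (forall w z, @polydisc R n z ->
       has_sum (fun alpha => a alpha w * monomial alpha z) (f w z)).
Proof.
move=> [f_hol f_meas].
have half01 : 0 < (2^-1 : R) < 1 by apply/andP; split; lra.
(* Limits are unique, so this choice does not endanger measurability: it comes from the
   approximants, finite combinations of values of [f] at fixed points. *)
have /choice[A fA] (aw : n.-tuple nat * Omega) :
    exists L, tends (coef (f aw.2) 2^-1 aw.1) L by exact: tends_coef.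
exists (fun alpha w => A (alpha, w)); split=> [alpha|w z /polydiscP z1].
  apply: (measurable_C_tends (u := fun N w => coef (f w) 2^-1 alpha N)).
    move=> N; apply: measurable_C_mean => y.
    under eq_fun do rewrite mulrC.
    by apply: measurable_CZ; apply: f_meas; exact: torus_polydisc.
  by move=> w; exact: (fA (alpha, w)).
pose M : R := \big[Num.max/0]_l modc (z l).
have M0 : 0 <= M by exact: bigmax_ge_id.
have M1 : M < 1 by apply: bigmax_lt => // l _; exact: z1.
(* Strictly between [M] and 1, and at least 2/3, hence above the radius 1/2 of the coefficients. *)
pose rho := (2 + M) / 3.
have rho01 : 0 < rho < 1 by rewrite /rho; apply/andP; split; lra.
have [B B0 fB] := torus_bounded (f_hol w) rho01.
have /choice[A' fA'] a := tends_coef (f_hol w) a rho01.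
have AA' a : A (a, w) = A' a.
  apply: (coef_radius_indep (f_hol w) rho01 fB fA' (r := 2^-1)) (fA (a, w)).
  by rewrite /rho; apply/andP; split; lra.
rewrite (_ : (fun alpha => _) = fun a => A' a * monomial a z); last first.
  by apply/funext => a; rewrite AA'.
apply: (power_series_has_sum (f_hol w) rho01 fB fA' B0) => l.
have : modc (z l) <= M by exact: le_bigmax_cond.
by rewrite /rho; lra.
Qed.
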